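(* Let $N\ge 2$, $\omega\in\mathbb{R}$, let $\mathbf{A}$ be a directed graph on $V_N=\{1,\dots,N\}$ without self-loops and with adjacency matrix $(A_{jk})$, and let $\mathbf{H}$ be a subgraph of $\mathbf{A}$ with vertex set $V_N$ that admits a spanning diverging tree. Then there is a coupling function $\mathrm{g}$ such that the oscillator network $$\dot\theta_k=\omega+\sum_{j=1}^N A_{jk}\,\mathrm{g}(\theta_j-\theta_k),\qquad k=1,\dots,N,$$ on $\mathbb{T}^N$ has an asymptotically stable relative equilibrium $(\Omega t+\theta^o_1,\dots,\Omega t+\theta^o_N)$ (for some $\Omega\in\mathbb{R}$, $\theta^o\in\mathbb{T}^N$) satisfying $\mathcal{G}_{\mathrm{g},\mathbf{A}}(\theta^o)=\mathbf{H}$. In other words, there exists a coupling function $\mathrm{g}$ that stably realises $\mathbf{H}$ for this network.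
   Context: $\mathbb{T}=\mathbb{R}/2\pi\mathbb{Z}$. The adjacency matrix has $A_{jk}=1$ if there is an edge $(j,k)$ from $j$ to $k$, and $A_{jk}=0$ otherwise; $A_{kk}=0$. A coupling function is a non-constant smooth function $\mathrm{g}:\mathbb{T}\to\mathbb{R}$. Let $\mathrm{LC}(\mathrm{g})$ be the set of points of $\mathbb{T}$ having an open neighbourhood on which $\mathrm{g}$ is constant, and $\mathrm{DZ}(\mathrm{g})$ the set of points having an open neighbourhood on which $\mathrm{g}\equiv 0$. All coupling functions are assumed to have simple dead zones: $\mathrm{DZ}(\mathrm{g})$ has finitely many connected components and $\mathrm{LC}(\mathrm{g})=\mathrm{DZ}(\mathrm{g})$. The effective coupling graph $\mathcal{G}_{\mathrm{g},\mathbf{A}}(\theta)$ at $\theta\in\mathbb{T}^N$ is the directed graph on $V_N$ with edge set $\{(j,k): A_{jk}\ne 0 \text{ and } \theta_j-\theta_k\notin\mathrm{DZ}(\mathrm{g})\}$. Put $\Theta_{\mathrm{g},\mathbf{A}}(\mathbf{H})=\{\theta\in\mathbb{T}^N:\mathcal{G}_{\mathrm{g},\mathbf{A}}(\theta)=\mathbf{H}\}$. A spanning diverging tree of a directed graph is a subgraph containing all vertices, whose underlying undirected graph is connected, such that one node (the root) has no incoming edges and every other node has exactly one incoming edge. The network is equivariant under the phase shifts $(\theta_1,\dots,\theta_N)\mapsto(\theta_1+\phi,\dots,\theta_N+\phi)$, $\phi\in\mathbb{T}$. A relative equilibrium is a solution of the form $(\Omega t+\theta^o_1,\dots,\Omega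 t+\theta^o_N)$, i.e. an equilibrium of the quotient system by phase shifts (phase-difference coordinates); it is asymptotically stable if the corresponding equilibrium of the quotient system is (locally) asymptotically stable. $\mathbf{H}$ is stably realised by $\mathrm{g}$ if there is a nonempty, (forward-)invariant, asymptotically stable open set $B\subset\mathbb{T}^N$ with $B\subset\Theta_{\mathrm{g},\mathbf{A}}(\mathbf{H})$. *)

(* Defs.v *)
From HB Require Import structures.
From mathcomp Require Import all_boot all_order all_algebra.
From mathcomp Require Import ring_quotient.
From mathcomp Require Import all_classical all_reals all_analysis.
Import Order.TTheory GRing.Theory Num.Theory.
Import numFieldNormedType.Exports.

Set Implicit Arguments.
Unset Strict Implicit.
Unset Printing Implicit Defensive.

Local Open Scope classical_set_scope.
Local Open Scope ring_scope.
Local Open Scope quotient_scope.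

Definition two_pi_int (R : realType) : {pred R} :=
  fun x => x / (2 * pi) \is a Num.int.

Lemma two_pi_int_zmod_closed (R : realType) : zmod_closed (@two_pi_int R).
Proof.
have E (x : R) : (x \in @two_pi_int R) = (x / (2 * pi) \is a Num.int) by [].
split=> [|x y]; rewrite !E; first by rewrite mul0r rpred0.
by move=> xZ yZ; rewrite mulrBl; exact: rpredB.
Qed.

HB.instance Definition _ (R : realType) :=
  GRing.isZmodClosed.Build R (@two_pi_int R) (@two_pi_int_zmod_closed R).

(* R / 2 pi Z, as a quotient group with the quotient topology. *)
Definition circle (R : realType) : Type := Quotient.quot (@two_pi_int R).

HB.instance Definition _ (R : realType) :=
  GRing.Zmodule.copy (circle R) (Quotient.quot (@two_pi_int R)).
HB.instance Definition _ (R : realType) :=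
  Quotient.copy (circle R) (Quotient.quot (@two_pi_int R)).

Definition to_circle (R : realType) (x : R) : circle R := \pi_(circle R) x.

Definition circle_open (R : realType) (U : set (circle R)) : Prop :=
  open (@to_circle R @^-1` U).

Lemma circle_openT (R : realType) : circle_open [set: circle R].
Proof. by rewrite /circle_open preimage_setT; exact: openT. Qed.

Lemma circle_openI (R : realType) : setI_closed (@circle_open R).
Proof. by move=> U V; exact: openI. Qed.

Lemma circle_open_bigcup (R : realType) (I : Type) (F : I -> set (circle R)) :
  (forall i, circle_open (F i)) -> circle_open (\bigcup_i F i).
Proof. by move=> oF; apply: bigcup_open => i _; exact: oF. Qed.

HB.instance Definition _ (R : realType) :=
  isOpenTopological.Build (circle R)
    (@circle_openT R) (@circle_openI R) (@circle_open_bigcup R).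

(* The torus T^N is 'rV[circle R]_N, with the product topology and the
   componentwise group structure. *)

Definition phase_shift (R : realType) (N : nat) : {pred 'rV[circle R]_N} :=
  fun theta => `[< exists phi : circle R, theta = const_mx phi >].

Lemma phase_shift_zmod_closed (R : realType) (N : nat) :
  zmod_closed (@phase_shift R N).
Proof.
have E (x : 'rV[circle R]_N) : (x \in @phase_shift R N) = @phase_shift R N x.
  by [].
split=> [|x y]; rewrite !E.
  by apply/asboolP; exists 0; apply/rowP => i; rewrite !mxE.
move=> /asboolP[a ->] /asboolP[b ->]; apply/asboolP; exists (a - b).
by apply/rowP => i; rewrite !mxE.
Qed.

HB.instance Definition _ (R : realType) (N : nat) :=
  GRing.isZmodClosed.Build 'rV[circle R]_N (@phase_shift R N)
    (@phase_shift_zmod_closed R N).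

(* The orbit space of T^N under phase shifts, with the quotient topology. *)
Definition phase_quotient (R : realType) (N : nat) : topologicalType :=
  @quotient_topology 'rV[circle R]_N (Quotient.quot (@phase_shift R N)).

Definition phase_class (R : realType) (N : nat) (theta : 'rV[circle R]_N) :
    phase_quotient R N :=
  \pi_(Quotient.quot (@phase_shift R N)) theta.

(* Directed graphs on 'I_N, given by their edge set; (j, k) is an edge from j
   to k. *)
Definition digraph (N : nat) := {set 'I_N * 'I_N}.

Definition loopless (N : nat) (A : digraph N) : Prop :=
  forall k, (k, k) \notin A.

Definition adjacency (R : realType) (N : nat) (A : digraph N) : 'M[R]_N :=
  \matrix_(j, k) ((j, k) \in A)%:R.

Definition in_degree (N : nat) (D : digraph N) (k : 'I_N) : nat :=
  #|[pred j | (j, k) \in D]|.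

Definition weakly_connected (N : nat) (D : digraph N) : Prop :=
  forall i j : 'I_N,
    connect (fun a b => ((a, b) \in D) || ((b, a) \in D)) i j.

Definition spanning_diverging_tree (N : nat) (H D : digraph N) : Prop :=
  [/\ D \subset H, weakly_connected D &
      exists r : 'I_N, in_degree D r = 0%N /\
        forall k, k != r -> in_degree D k = 1%N].

Definition locally_constant_set (R : realType) (g : circle R -> R) :
    set (circle R) :=
  [set x | exists2 U, open_nbhs x U & exists c, forall y, U y -> g y = c].

Definition dead_zone (R : realType) (g : circle R -> R) : set (circle R) :=
  [set x | exists2 U, open_nbhs x U & forall y, U y -> g y = 0].

Definition smooth (R : realType) (g : circle R -> R) : Prop :=
  forall (n : nat) (x : R), derivable (derive1n n (g \o @to_circle R)) x 1.

Definition simple_dead_zones (R : realType) (g : circle R -> R) : Prop :=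
  finite_set [set connected_component (dead_zone g) x | x in dead_zone g] /\
  locally_constant_set g = dead_zone g.

Definition coupling_function (R : realType) (g : circle R -> R) : Prop :=
  [/\ smooth g, ~ (exists c, forall x, g x = c) & simple_dead_zones g].

Definition effective_graph (R : realType) (N : nat) (g : circle R -> R)
    (A : digraph N) (theta : 'rV[circle R]_N) : digraph N :=
  [set e : 'I_N * 'I_N | (adjacency R A e.1 e.2 != 0) &&
     `[< ~ dead_zone g (theta 0 e.1 - theta 0 e.2) >]]%SET.

Definition realising_set (R : realType) (N : nat) (g : circle R -> R)
    (A H : digraph N) : set 'rV[circle R]_N :=
  [set theta | effective_graph g A theta = H].

Definition network_field (R : realType) (N : nat) (omega : R) (A : digraph N)
    (g : circle R -> R) (theta : 'rV[circle R]_N) (k : 'I_N) : R :=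
  omega + \sum_(j < N) adjacency R A j k * g (theta 0 j - theta 0 k).

(* The derivative of a curve in the circle is that of a lift to R. *)
Definition has_velocity (R : realType) (u : R -> circle R) (v : R -> R) :
    Prop :=
  exists x : R -> R, (forall t, u t = to_circle (x t)) /\
    forall t : R, is_derive t 1 x (v t).

(* Solutions are taken on the whole time axis: for smooth g the field is smooth
   on the compact manifold T^N, so every maximal solution is global. *)
Definition solutions (R : realType) (N : nat) (omega : R) (A : digraph N)
    (g : circle R -> R) : set (R -> 'rV[circle R]_N) :=
  [set theta : R -> 'rV[circle R]_N |
     forall k, has_velocity (fun t => theta t 0 k)
                 (fun t => network_field omega A g (theta t) k)].

Definition quotient_solutions (R : realType) (N : nat) (omega : R)
    (A : digraph N) (g : circle R -> R) : set (R -> phase_quotient R N) :=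
  [set (fun t => phase_class (theta t)) | theta in solutions omega A g].

Definition forward_invariant (R : realType) (X : Type) (S : set (R -> X))
    (B : set X) : Prop :=
  forall u, S u -> B (u 0) -> forall t, 0 <= t -> B (u t).

(* Lyapunov stability together with local attraction, for the curves in S and
   the filter F of neighbourhoods of the object under study. *)
Definition asymptotically_stable_filter (R : realType) (X : topologicalType)
    (S : set (R -> X)) (F : set_system X) : Prop :=
  (forall U, F U -> exists2 V, F V &
     forall u, S u -> V (u 0) -> forall t, 0 <= t -> U (u t)) /\
  (exists2 W, F W & forall u, S u -> W (u 0) -> u @ +oo --> F).

Definition asymptotically_stable_point (R : realType) (X : topologicalType)
    (S : set (R -> X)) (x : X) : Prop :=
  asymptotically_stable_filter S (nbhs x).

(* For an open set, neighbourhoods are taken around its closure: in the compact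
   space T^N these are the sets containing some {y | dist(y, B) < e}, 0 < e, so
   this is the usual notion formulated with the distance to B. Neighbourhoods
   of B itself would make every forward invariant open set stable. *)
Definition asymptotically_stable_set (R : realType) (X : topologicalType)
    (S : set (R -> X)) (B : set X) : Prop :=
  asymptotically_stable_filter S (set_nbhs (closure B)).

Definition rotating_wave (R : realType) (N : nat) (Omega : R)
    (theta0 : 'rV[circle R]_N) (t : R) : 'rV[circle R]_N :=
  \row_k (to_circle (Omega * t) + theta0 0 k).

Definition relative_equilibrium (R : realType) (N : nat) (omega : R)
    (A : digraph N) (g : circle R -> R) (Omega : R)
    (theta0 : 'rV[circle R]_N) : Prop :=
  solutions omega A g (rotating_wave Omega theta0).

Definition stable_relative_equilibrium (R : realType) (N : nat) (omega : R)
    (A : digraph N) (g : circle R -> R) (Omega : R)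
    (theta0 : 'rV[circle R]_N) : Prop :=
  relative_equilibrium omega A g Omega theta0 /\
  asymptotically_stable_point (quotient_solutions omega A g)
    (phase_class theta0).

Definition stably_realises (R : realType) (N : nat) (omega : R)
    (A H : digraph N) (g : circle R -> R) : Prop :=
  exists B : set 'rV[circle R]_N,
    [/\ B !=set0, open B, forward_invariant (solutions omega A g) B,
        asymptotically_stable_set (solutions omega A g) B &
        B `<=` realising_set g A H].

(* Main.v *)
Require Import Defs.
From mathcomp Require Import all_boot all_order all_algebra.
From mathcomp Require Import all_classical all_reals all_analysis.
From mathcomp Require Import ring lra zify.
Import Order.TTheory GRing.Theory Num.Theory.
Import numFieldNormedType.Exports.

Set Implicit Arguments.
Unset Strict Implicit.
Unset Printing Implicit Defensive.

Local Open Scope classical_set_scope.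
Local Open Scope ring_scope.

(** Choose reference phases [phi] whose pairwise differences are all distinct on
    the circle. The coupling function can then be designed separately near the
    phase difference of every ordered pair [(j, k)]: it vanishes identically near
    the differences of the pairs outside [H], and near those of the edges of [H]
    it is a bump with a simple zero of positive slope [sg j k] at the difference
    itself. Since all these values are zero, [phi] rotates rigidly with frequency
    [omega], and the effective coupling graph is [H] at [phi] and at all points
    whose phase differences are close to those of [phi] ([exists_coupling]).

    In the displacement [x] from the rotating [phi] the dynamics is, to first
    order, the consensus dynamics [x_k' = \sum_j sg j k (x_j - x_k)]. The slopes are free, so
    they are chosen to make stability elementary: on the edges of the spanning
    diverging tree they decrease geometrically with the depth, and on the other
    edges of [H] they are so small that these edges, like the nonlinear part of
    the coupling, are mere perturbations of the tree. With [r] the root,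
    [dev x = \sum_k (x_k - x_r)^2] is then a strict Lyapunov function: a vertex
    is damped with its own weight and excites only its children, whose total
    weight is at most half of its own ([tree_dissipation],
    [perturbed_dissipation]).

    Consequently the tubes [dev < v], for small [v], contract exponentially along
    all solutions ([tube_contracts]). In the quotient by phase shifts they form a
    basis of neighbourhoods of the class of [phi], which is therefore
    asymptotically stable ([stable_class]). A single tube is open and forward
    invariant, and, by compactness, the larger tubes form a basis of
    neighbourhoods of its closure ([tube_basis]), which makes it an asymptotically
    stable set ([stable_tube]).

    The delicate requirement on the coupling function is that it be locally
    constant only where it vanishes, with finitely many dead zones. Superposing
    translates of one explicit bump with disjoint supports reduces the former to
    a monotonicity argument for that bump ([bump_locally_constant]), and placing
    the translates on a regular mesh makes the latter a count of mesh cells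
    ([dead_zone_components]). *)

(** * Smooth functions on the line and the flat function *)

Section Smooth.
Variable R : realType.
Implicit Types f g : R -> R.

(** [diffn n f] asks for [n] successive derivatives given as total functions,
    a form that is stable under products and compositions by induction. *)
Fixpoint diffn n f : Prop :=
  if n is m.+1 then
    exists2 f' : R -> R, (forall x : R, is_derive x 1 f (f' x)) & diffn m f'
  else True.

Lemma diffnW n f : diffn n.+1 f -> diffn n f.
Proof.
elim: n f => [//|n IH] f [f' ff' Cf']; exists f' => //; exact: IH.
Qed.

Lemma diffn_cst n (c : R) : diffn n (fun=> c).
Proof.
by elim: n c => [//|n IH] c; exists (fun=> 0) => // x; exact: is_derive_cst.
Qed.

Lemma diffn_add n f g : diffn n f -> diffn n g -> diffn n (fun x => f x + g x).
Proof.
elim: n f g => [//|n IH] f g [f' ff' Cf'] [g' gg' Cg'].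
exists (fun x => f' x + g' x); last exact: IH.
by move=> x; exact: (@is_deriveD _ _ _ f g).
Qed.

Lemma diffn_mul n f g : diffn n f -> diffn n g -> diffn n (fun x => f x * g x).
Proof.
elim: n f g => [//|n IH] f g Cf Cg.
have [f' ff' Cf'] := Cf; have [g' gg' Cg'] := Cg.
exists (fun x => f x * g' x + g x * f' x).
  by move=> x; exact: (@is_deriveM _ _ f g).
by apply: diffn_add; apply: IH => //; exact: diffnW.
Qed.

Lemma diffn_comp n f g : diffn n f -> diffn n g -> diffn n (f \o g).
Proof.
elim: n f g => [//|n IH] f g Cf Cg.
have [f' ff' Cf'] := Cf; have [g' gg' Cg'] := Cg.
exists (fun x => (f' \o g) x * g' x); first by move=> x; exact: is_derive1_comp.
by apply: diffn_mul => //; apply: IH => //; exact: diffnW.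
Qed.

Lemma diffn_sum n (I : Type) (r : seq I) (P : pred I) (F : I -> R -> R) :
  (forall i, P i -> diffn n (F i)) -> diffn n (fun x => \sum_(i <- r | P i) F i x).
Proof.
move=> CF; elim: r => [|i r IH].
  rewrite (_ : (fun _ => _) = fun=> 0); first exact: diffn_cst.
  by apply/funext => x; rewrite big_nil.
have [Pi|nPi] := boolP (P i); last first.
  rewrite (_ : (fun _ => _) = fun x => \sum_(i <- r | P i) F i x) //.
  by apply/funext => x; rewrite big_cons (negbTE nPi).
rewrite (_ : (fun _ => _) = fun x => F i x + \sum_(i <- r | P i) F i x).
  by apply: diffn_add => //; exact: CF.
by apply/funext => x; rewrite big_cons Pi.
Qed.

Lemma diffn_shift n (a : R) : diffn n (fun x => x - a).
Proof.
apply: diffn_add; last exact: diffn_cst.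
case: n => [//|n]; exists (fun=> 1) => [x|]; last exact: diffn_cst.
exact: is_derive_id.
Qed.

Lemma diffn_sincos n : diffn n (@sin R) /\ diffn n (@cos R).
Proof.
elim: n => [//|n [Cs Cc]]; split.
  by exists (@cos R) => // x; exact: is_derive_sin.
exists (fun x => -1 * @sin R x); last exact: (diffn_mul (diffn_cst _ _) Cs).
by move=> x; apply: is_derive_eq; rewrite mulN1r.
Qed.

Lemma diffn_derive1n f : (forall n, diffn n f) ->
  forall n (x : R), derivable (derive1n n f) x 1.
Proof.
move=> Cf n x; have := Cf n.+1; rewrite /derive1n; elim: n f {Cf} => [|n IH] f.
  by case=> f' ff' _; have [] := ff' x.
case=> f' ff' Cf'; rewrite iterSr.
suff -> : f^`()%classic = f' by exact: IH.
by apply/funext => y; rewrite derive1E; have [] := ff' y.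
Qed.

(** The family [u^-n exp(-1/u)], extended by 0 to [u <= 0], is closed under
    differentiation up to linear combinations, so that the classical flat
    function [flat 0] can be differentiated without polynomials in [1/u]. *)
Definition flat n (u : R) : R :=
  if 0 < u then u^-1 ^+ n * expR (- u^-1) else 0.

Lemma flat_ge0 n u : 0 <= flat n u.
Proof.
rewrite /flat; case: ifPn => // u0.
by rewrite mulr_ge0 ?expR_ge0// exprn_ge0// invr_ge0 ltW.
Qed.

Lemma flat_gt0 n u : 0 < u -> 0 < flat n u.
Proof.
by move=> u0; rewrite /flat u0 mulr_gt0 ?expR_gt0// exprn_gt0// invr_gt0.
Qed.

Lemma flat_le0 n u : u <= 0 -> flat n u = 0.
Proof. by rewrite /flat ltNge => ->. Qed.

(** With [v = 1/u], since [v^(n+1) / (n+1)! <= exp v], the exponential absorbs the pole of order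
    [n] together with one more factor [1/u]. *)
Lemma flat_bound n u : flat n u <= (n.+1)`!%:R * `|u|.
Proof.
rewrite /flat; case: ifPn => u0; last by rewrite mulr_ge0.
have v0 : 0 < u^-1 by rewrite invr_gt0.
rewrite gtr0_norm// -[u in X in _ <= X]invrK; move: v0; set v := u^-1 => v0.
have f0 : 0 < n.+1`!%:R :> R by rewrite ltr0n fact_gt0.
have := expR_ge1Dxn n (ltW v0); rewrite expRN => h.
rewrite ler_pdivlMr// mulrAC -exprSr ler_pdivrMr ?expR_gt0//.
by rewrite mulrC -ler_pdivrMr//; apply: le_trans h; rewrite lerDr.
Qed.

(** At 0 the difference quotient of [flat n] is [flat n.+1], which is continuous
    there by [flat_bound]. *)
Lemma is_derive_flat n (x : R) :
  is_derive x 1 (flat n) (flat n.+2 x - n%:R * flat n.+1 x).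
Proof.
have [x0|x0|->] := ltrgt0P x.
- pose h := (fun y : R => y^-1 ^+ n * expR (- y^-1)).
  apply: (@near_eq_is_derive _ _ _ h).
    by near=> y; rewrite /flat ifT//; near: y; exact: lt_nbhsr.
  have x1 : x != 0 by rewrite gt_eqF.
  have dV : is_derive x 1 (fun y : R => y^-1) (- x ^- 2).
    have := @is_deriveV R id x 1 1 x1 (is_derive_id _ _).
    by rewrite /GRing.scale/= mulr1.
  have dX : is_derive x 1 (fun y : R => y^-1 ^+ n)
      (n%:R * x^-1 ^+ n.-1 * - x ^- 2).
    rewrite (_ : (fun y : R => y^-1 ^+ n) = (fun y : R => y^-1) ^+ n); last first.
      by apply/funext => y; rewrite exprfctE.
    exact: (@is_deriveX _ _ (fun y : R => y^-1)).
  have dE : is_derive x 1 (fun y : R => expR (- y^-1)) (expR (- x^-1) * x ^- 2).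
    apply: (@is_derive1_comp _ expR (fun y : R => - y^-1)).
    by rewrite -[x ^- 2]opprK; exact: (@is_deriveN _ _ _ (fun y : R => y^-1)).
  rewrite /h; apply: is_derive_eq.
  rewrite /flat x0 /GRing.scale/= -!exprVn !exprS.
  by case: n h dX => [|n] h dX /=; rewrite ?exprS ?expr0; ring.
- apply: (@near_eq_is_derive _ _ _ (cst 0)).
    near=> y; rewrite flat_le0//; apply: ltW; near: y; exact: lt_nbhsl.
  by rewrite !flat_le0 ?ltW// mulr0 subr0; exact: is_derive_cst.
- rewrite !flat_le0// mulr0 subr0; apply/is_derive1_caratheodory.
  exists (flat n.+1); split; last by rewrite flat_le0.
  + move=> z; rewrite [flat n 0]flat_le0// !subr0 /flat.
    case: ifPn => [z0|_]; last by rewrite mul0r.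
    rewrite exprSr; set a := _ ^+ n; set b := expR _; field.
    by rewrite gt_eqF.
  + have f0 : flat n.+1 0 = 0 by rewrite flat_le0.
    rewrite /prop_for/= /continuous_at f0.
    apply: (@squeeze_cvgr _ _ _ _ (fun=> 0) (fun z => (n.+2)`!%:R * `|z|)).
    * by near=> z; rewrite flat_ge0 flat_bound.
    * exact: cvg_cst.
    * rewrite -[0 in X in _ --> X](mulr0 (n.+2)`!%:R); apply: cvgMr.
      by rewrite -[0 in X in _ --> X](normr0 R); apply: cvg_norm; exact: cvg_id.
Unshelve. all: by end_near. Qed.

Lemma diffn_flat m n : diffn m (flat n).
Proof.
elim: m n => [//|m IH] n.
exists (fun x => flat n.+2 x + - n%:R * flat n.+1 x).
  by move=> x; have := is_derive_flat n x; rewrite mulNr.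
by apply: diffn_add => //; apply: diffn_mul => //; exact: diffn_cst.
Qed.
End Smooth.

(** * A periodic odd bump *)

Section Bump.
Variable R : realType.

Lemma periodic_int (f : R -> R) (T : R) : periodic f T ->
  forall (m : int) x, f (x + T * m%:~R) = f x.
Proof.
move=> fT [n|n] x.
  by rewrite -pmulrn mulr_natr periodicn.
rewrite NegzE mulrNz mulrN -pmulrn mulr_natr -[in RHS](subrK (T *+ n.+1) x).
by rewrite periodicn.
Qed.

Lemma cos_int (m : int) (x : R) : cos (x + 2 * pi * m%:~R) = cos x.
Proof. by rewrite -(periodic_int (@cosD2pi R) m x) mulr_natl. Qed.

Lemma sin_int (m : int) (x : R) : sin (x + 2 * pi * m%:~R) = sin x.
Proof. by rewrite -(periodic_int (@sinD2pi R) m x) mulr_natl. Qed.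

Lemma two_pi_gt0 : 0 < 2 * pi :> R.
Proof. by rewrite mulr_gt0// pi_gt0. Qed.

Lemma mod_two_pi (a x : R) :
  exists m : int, a <= x + 2 * pi * m%:~R < a + 2 * pi.
Proof.
have P := two_pi_gt0; exists (- Num.floor ((x - a) / (2 * pi))).
have /andP[] := Num.Theory.floor_itv ((x - a) / (2 * pi)).
rewrite ler_pdivlMr// ltr_pdivrMr// intrD.
set f := (Num.floor _)%:~R => h1 h2.
rewrite mulrNz -/f; apply/andP; split; nra.
Qed.

Lemma cos_lt_near (rho x : R) : 0 <= rho <= pi -> `|x| < rho -> cos rho < cos x.
Proof.
move=> /andP[r0 rpi] xr; rewrite -(cos_norm x) ltr_cos//.
  by rewrite in_itv/= normr_ge0/=; apply: ltW; apply: lt_le_trans rpi.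
by rewrite in_itv/= r0.
Qed.

Lemma cos_le_near (rho x : R) : 0 <= rho <= pi -> `|x| <= rho -> cos rho <= cos x.
Proof.
move=> r; rewrite le_eqVlt => /predU1P[<-|]; first by rewrite cos_norm.
by move=> /(cos_lt_near r)/ltW.
Qed.

Lemma near_cos_le (rho x : R) : 0 <= rho <= pi -> cos rho <= cos x ->
  exists m : int, `|x + 2 * pi * m%:~R| <= rho.
Proof.
move=> /andP[r0 rpi] cx; have [m /andP[m1 m2]] := mod_two_pi (- pi) x.
exists m; rewrite leNgt; apply/negP => h.
suff : cos x < cos rho by rewrite ltNge cx.
have xpi : `|x + 2 * pi * m%:~R| <= pi by rewrite ler_norml m1/=; lra.
by rewrite -(cos_int m x) -cos_norm ltr_cos// in_itv/= ?r0 ?normr_ge0 ?xpi.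
Qed.

Variable rho : R.

(** The sine, cut off smoothly outside the arcs of half-width [rho] around the
    multiples of [2 pi] and normalised to have slope 1 at 0. Writing the cut-off
    in terms of [cos x] makes periodicity and smoothness automatic. *)
Definition bump (x : R) : R :=
  (flat 0 (1 - cos rho))^-1 * (sin x * flat 0 (cos x - cos rho)).

Lemma diffn_bump n : diffn n bump.
Proof.
apply: diffn_mul; first exact: diffn_cst.
apply: diffn_mul; first exact: (diffn_sincos R n).1.
apply: (@diffn_comp _ _ (flat 0) (fun x => cos x - cos rho)); first exact: diffn_flat.
apply: (@diffn_comp _ _ (fun x => x - cos rho) cos); first exact: diffn_shift.
exact: (diffn_sincos R n).2.
Qed.

Lemma bump_int (m : int) x : bump (x + 2 * pi * m%:~R) = bump x.
Proof. by rewrite /bump cos_int sin_int. Qed.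

Lemma bump0 : bump 0 = 0. Proof. by rewrite /bump sin0 mul0r mulr0. Qed.

Lemma bump_eq0 x : cos x <= cos rho -> bump x = 0.
Proof. by move=> h; rewrite /bump [flat _ (cos x - _)]flat_le0 ?subr_le0// !mulr0. Qed.

Lemma is_derive_bump (x : R) : is_derive x 1 bump ((flat 0 (1 - cos rho))^-1 *
  (cos x * flat 0 (cos x - cos rho) - sin x ^+ 2 * flat 2 (cos x - cos rho))).
Proof.
have d1 : is_derive x 1 (fun x : R => cos x - cos rho) (- sin x - 0).
  exact: (@is_deriveB _ _ _ cos (cst (cos rho))).
have d2 := @is_derive1_comp _ (flat 0) (fun x => cos x - cos rho) x _ _
   (is_derive_flat 0 _) d1.
have d3 := @is_deriveM _ _ _ _ _ _ _ _ (is_derive_sin x) d2.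
have d4 := @is_deriveZ _ _ _ _ (flat 0 (1 - cos rho))^-1 _ _ _ d3.
apply: (@is_derive_eq _ _ _ _ _ _ _ _ d4).
by rewrite /GRing.scale/= mul0r !subr0; ring.
Qed.

Hypothesis rho_gt0 : 0 < rho.
Hypothesis rho_le : rho <= pi / 2.

Let rho_lepi : 0 <= rho <= pi.
Proof.
rewrite ltW//=; apply: le_trans rho_le _.
by rewrite ler_pdivrMr// ler_peMr ?pi_ge0// ler1n.
Qed.

Let cr_ge0 : 0 <= cos rho.
Proof.
apply: cos_ge0_pihalf; rewrite rho_le andbT; apply: le_trans (ltW rho_gt0).
by rewrite oppr_le0 divr_ge0 ?pi_ge0.
Qed.

Let cr_lt1 : cos rho < 1.
Proof.
rewrite -[X in _ < X](cos0 R); apply: cos_lt_near => //; by rewrite normr0.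
Qed.

Let mu_gt0 : 0 < flat 0 (1 - cos rho).
Proof. by apply: flat_gt0; rewrite subr_gt0. Qed.

Lemma bump_neq0 x : cos rho < cos x -> sin x != 0 -> bump x != 0.
Proof.
move=> cx sx; apply: mulf_neq0; first by rewrite invr_eq0 gt_eqF.
by apply: mulf_neq0 => //; rewrite gt_eqF// flat_gt0// subr_gt0.
Qed.

Lemma bump_near_neq0 s : `|s| < rho -> s != 0 -> bump s != 0.
Proof.
move=> sr s0; have pi0 := pi_gt0 R.
apply: bump_neq0; first exact: cos_lt_near.
move: sr s0; wlog s0 : s / 0 < s => [H|] sr sn0.
  have [s_gt0|s_lt0] := ltP 0 s; first exact: H.
  have := H (- s); rewrite normrN oppr_eq0 sinN oppr_eq0; apply=> //.
  by rewrite oppr_gt0 lt_neqAle sn0.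
rewrite gt_eqF// sin_gt0_pi// s0/=.
have /andP[_ rpi] := rho_lepi.
by apply: lt_le_trans rpi; rewrite -(gtr0_norm s0).
Qed.

Lemma bump_linear (tau : R) : 0 < tau -> exists2 e, 0 < e &
  forall s, `|s| < e -> `|bump s - s| <= tau * `|s|.
Proof.
move=> tau0.
have := is_derive_bump 0; rewrite cos0 sin0 expr0n/= mul0r subr0 mul1r mulVf ?gt_eqF//.
move=> /is_derive1_caratheodory[h [hE hc h0]].
move/cvgrPdist_lt: hc => /(_ _ tau0).
move=> [e /= e0 he]; exists e => // s se.
have := hE s; rewrite bump0 !subr0 => ->.
rewrite -[X in _ - X]mul1r -mulrBl normrM ler_wpM2r// ltW// -h0 distrC.
by apply: he; rewrite /= sub0r normrN.
Qed.

(** Where [bump] is constant with a nonzero value, its derivative vanishes, which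
    says that, for [y] near [x], [p = cos y] is a root of
    [p (p - cos rho)^2 + p^2 - 1]. This function increases strictly for
    [p > cos rho >= 0], so [cos] would be constant near [x], whence [sin x = 0]
    and [bump x = 0]. *)
Lemma bump_locally_constant x (e c : R) : 0 < e ->
  (forall y, `|y - x| < e -> bump y = c) -> c = 0.
Proof.
move=> e0 bc; apply/eqP; apply/negPn/negP => c0.
have inball y : `|y - x| < e -> \forall z \near y, `|z - x| < e.
  move=> yx; near=> z.
  rewrite (_ : z - x = (z - y) + (y - x)); last by ring.
  rewrite (le_lt_trans (ler_normD _ _))// -ltrBrDr distrC.
  near: z; apply: (@nbhsx_ballx _ R y); by rewrite subr_gt0.
have key y : `|y - x| < e -> cos rho < cos y /\
    cos y * (cos y - cos rho) ^+ 2 = 1 - cos y ^+ 2.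
  move=> yx; have cy : cos rho < cos y.
    by rewrite ltNge; apply: contra c0 => /bump_eq0; rewrite (bc _ yx) => ->.
  split => //.
  have d0 : is_derive y 1 bump 0.
    have dc : is_derive y 1 (cst c : R -> R) 0 by exact: is_derive_cst.
    apply: near_eq_is_derive dc; near=> z; rewrite bc//; near: z; exact: inball.
  have := is_derive_bump y; move: d0 => [_ d0] [_]; rewrite d0 => /esym/eqP.
  rewrite mulf_eq0 invr_eq0 gt_eqF//= subr_eq0 => /eqP.
  have u0 : 0 < cos y - cos rho by rewrite subr_gt0.
  rewrite /flat u0 -sin2cos2 expr0 mul1r mulrA => /mulIf E.
  have {}E := E (negbT (gt_eqF (expR_gt0 _))).
  by rewrite [X in X * _]E -mulrA -exprMn mulVf ?gt_eqF// expr1n mulr1.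
have cst_cos y : `|y - x| < e -> cos y = cos x.
  have mono p q : cos rho < p -> p < q ->
      p * (p - cos rho) ^+ 2 + p ^+ 2 < q * (q - cos rho) ^+ 2 + q ^+ 2.
    have c00 := cr_ge0; move=> hp pq.
    apply: ltrD; last by rewrite ltr_pXn2r// nnegrE; lra.
    apply: ltr_pM => //; [lra|exact: sqr_ge0|].
    by rewrite ltr_pXn2r ?nnegrE//; lra.
  move=> yx; have [cy ey] := key _ yx.
  have [|cx ex] := key x; first by rewrite subrr normr0.
  have [h|h|//] := ltgtP (cos y) (cos x).
    by have {}h := mono _ _ cy h; lra.
  by have {}h := mono _ _ cx h; lra.
have xx : `|x - x| < e by rewrite subrr normr0.
have : is_derive x 1 (@cos R) 0.
  have dc : is_derive x 1 (cst (cos x) : R -> R) 0 by exact: is_derive_cst.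
  apply: near_eq_is_derive dc; near=> z; rewrite cst_cos//; near: z; exact: inball.
move=> [_ d0]; have [_] := is_derive_cos x; rewrite d0 => /eqP.
rewrite eq_sym oppr_eq0 => /eqP sx.
by move: c0; rewrite -(bc x xx) /bump sx mul0r mulr0 eqxx.
Unshelve. all: by end_near. Qed.

End Bump.

(** * The circle as a quotient of the line *)

Section Circle.
Variable R : realType.
Local Open Scope quotient_scope.

Lemma to_circleD (x y : R) : to_circle (x + y) = to_circle x + to_circle y.
Proof. by rewrite /to_circle !piE. Qed.

Lemma to_circleB (x y : R) : to_circle (x - y) = to_circle x - to_circle y.
Proof. by rewrite /to_circle !piE. Qed.

Lemma to_circle_eq (x y : R) :
  to_circle x = to_circle y <-> exists m : int, x = y + 2 * pi * m%:~R.
Proof.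
have P := two_pi_gt0 R.
rewrite /to_circle; split.
  move=> /eqP; rewrite -Quotient.idealrBE => /intrP[m hm]; exists m.
  by rewrite mulrC -hm mulfVK ?gt_eqF// addrC subrK.
move=> [m ->]; apply/eqP; rewrite -Quotient.idealrBE.
rewrite addrAC subrr add0r; apply/intrP; exists m.
by rewrite mulrAC mulfV ?gt_eqF// mul1r.
Qed.

Lemma to_circle_int (m : int) (x : R) :
  to_circle (x + 2 * pi * m%:~R) = to_circle x.
Proof. by apply/to_circle_eq; exists m. Qed.

Lemma to_circle_surj (a : R) (z : circle R) :
  exists2 x, a <= x < a + 2 * pi & z = to_circle x.
Proof.
have [m mP] := mod_two_pi a (repr z); exists (repr z + 2 * pi * m%:~R) => //.
by rewrite to_circle_int /to_circle reprK.
Qed.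

Lemma periodic_repr (T : Type) (f : R -> T) :
  (forall (m : int) x, f (x + 2 * pi * m%:~R) = f x) ->
  forall x, f (repr (to_circle x)) = f x.
Proof.
move=> fP x; have /to_circle_eq[m ->] : to_circle (repr (to_circle x)) = to_circle x.
  by rewrite /to_circle reprK.
exact: fP.
Qed.

Lemma continuous_to_circle : continuous (@to_circle R).
Proof. by apply/continuousP => A. Qed.

Lemma nbhs_to_circle (x : R) (U : set (circle R)) : nbhs (to_circle x) U ->
  exists2 e, 0 < e & forall y, `|y - x| < e -> U (to_circle y).
Proof.
move=> /continuous_to_circle[e /= e0 he]; exists e => // y yx.
by apply: he; rewrite /= distrC.
Qed.

(** [to_circle] is an open map: the saturation of an interval is a union of its
    translates. *)
Lemma to_circle_nbhs (x e : R) : 0 < e ->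
  nbhs (to_circle x) [set to_circle y | y in [set y | `|y - x| < e]].
Proof.
move=> e0; set U := (X in nbhs _ X); rewrite nbhsE; exists U => //; split; last first.
  by exists x => //=; rewrite subrr normr0.
rewrite [open _]/(circle_open _) /circle_open.
rewrite openE => y [y' /= y'x /to_circle_eq[m E]]; rewrite /interior.
have : 0 < e - `|y' - x| by rewrite subr_gt0.
move=> /(@nbhsx_ballx _ R y); apply: filterS => z; rewrite /ball/= => yz.
exists (z + 2 * pi * m%:~R); last by rewrite to_circle_int.
rewrite /= (_ : _ - x = (y' - x) - (y - z)); last by rewrite E; ring.
by rewrite (le_lt_trans (ler_normB _ _))// -ltrBrDl.
Qed.

End Circle.

(** * Coupling functions with prescribed live points *)

(** Bumps are placed at the points [center e], [e \in H], of the mesh of step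
    [pi / K], where [n] labels the points of a finite set [S] injectively modulo
    [2 K]. The elements of [S] outside [H] mark points that must be dead. *)
Section Coupling.
Variables (R : realType) (T : finType) (K : nat) (n : T -> int).
Variables (S H : {set T}) (sg : T -> R).
Hypothesis K_gt0 : (0 < K)%N.
Hypothesis n_sep : forall e e', e \in S -> e' \in S -> e != e' ->
  forall m : int, n e - n e' + (2 * K)%:Z * m != 0.
Hypothesis HS : H \subset S.
Hypothesis sg_gt0 : forall e, e \in H -> 0 < sg e.

Definition mesh : R := pi / K%:R.
Definition center (e : T) : R := mesh * (n e)%:~R.
(* A third of the step: closed arcs of half-width [rho] around two different
   mesh points are disjoint. *)
Let rho : R := mesh / 3.

Let mesh_gt0 : 0 < mesh.
Proof. by rewrite divr_gt0 ?pi_gt0// ltr0n. Qed.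

Let mesh_le_pi : mesh <= pi.
Proof. by rewrite ler_pdivrMr ?ltr0n// ler_peMr ?pi_ge0// ler1n. Qed.

Let two_pi_mesh : 2 * pi = mesh * (2 * K)%:R.
Proof. by rewrite /mesh natrM; field; rewrite pnatr_eq0 -lt0n. Qed.

Let rho_gt0 : 0 < rho. Proof. by rewrite divr_gt0. Qed.

Let rho_le : rho <= pi / 2.
Proof. have a := mesh_gt0; have b := mesh_le_pi; rewrite /rho; lra. Qed.

Let rho_pi : 0 <= rho <= pi.
Proof.
have a := mesh_gt0; have b := mesh_le_pi.
by rewrite /rho; apply/andP; split; lra.
Qed.

Definition coupling (z : circle R) : R :=
  \sum_(e in H) sg e * bump rho (repr z - center e).

Lemma couplingE x :
  coupling (to_circle x) = \sum_(e in H) sg e * bump rho (x - center e).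
Proof.
apply: (periodic_repr
  (f := fun x => \sum_(e in H) sg e * bump rho (x - center e))).
move=> m y; apply: eq_bigr => e _; congr (_ * _).
by rewrite addrAC bump_int.
Qed.

Lemma coupling_smooth : smooth coupling.
Proof.
rewrite /smooth
  (_ : _ \o _ = fun x => \sum_(e in H) sg e * bump rho (x - center e)).
  apply: diffn_derive1n => k; apply: diffn_sum => e _; apply: diffn_mul.
    exact: diffn_cst.
  apply: (@diffn_comp _ _ (bump rho) (fun x => x - center e)).
    exact: diffn_bump.
  exact: diffn_shift.
by apply/funext => x; exact: couplingE.
Qed.

Lemma center_sep e e' (m : int) : e \in S -> e' \in S -> e != e' ->
  mesh <= `|center e - center e' + 2 * pi * m%:~R|.
Proof.
move=> eS e'S ee'; rewrite two_pi_mesh /center -mulrBr -mulrA -mulrDr.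
rewrite -[((2 * K)%:R)]/((2 * K)%:Z%:~R) -intrB -intrM -intrD.
rewrite normrM gtr0_norm// ler_pMr//.
rewrite -intr_norm ler1z -gtz0_ge1 normr_gt0.
exact: n_sep.
Qed.

(** Two centres are at least a step apart modulo [2 pi], and a step exceeds
    [2 rho]: near a centre all other bumps vanish. *)
Lemma bump_disjoint e0 x : e0 \in S -> cos rho <= cos (x - center e0) ->
  forall e, e \in H -> e != e0 -> bump rho (x - center e) = 0.
Proof.
move=> e0S c0 e eH ee0; apply: bump_eq0; rewrite leNgt; apply/negP => /ltW c1.
have [m0 h0] := near_cos_le rho_pi c0; have [m1 h1] := near_cos_le rho_pi c1.
have := @center_sep e e0 (m0 - m1) (fintype.subsetP HS _ eH) e0S ee0.
rewrite (_ : center e - center e0 + _ =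
  (x - center e0 + 2 * pi * m0%:~R) - (x - center e + 2 * pi * m1%:~R)); last first.
  by rewrite intrB; ring.
apply/negP; rewrite -ltNge (le_lt_trans (ler_normB _ _))//.
rewrite (le_lt_trans (lerD h0 h1))// /rho.
have a := mesh_gt0; lra.
Qed.

Lemma coupling_on e0 x : e0 \in H -> cos rho <= cos (x - center e0) ->
  coupling (to_circle x) = sg e0 * bump rho (x - center e0).
Proof.
move=> e0H c0; rewrite couplingE (bigD1 e0)//= big1 ?addr0// => e /andP[eH ee0].
by rewrite (@bump_disjoint e0)// ?mulr0//; exact: (fintype.subsetP HS).
Qed.

Lemma coupling_off e0 x : e0 \in S -> e0 \notin H ->
  cos rho <= cos (x - center e0) -> coupling (to_circle x) = 0.
Proof.
move=> e0S e0H c0; rewrite couplingE big1// => e eH.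
rewrite (@bump_disjoint e0)// ?mulr0//.
by apply: contraNneq e0H => <-.
Qed.

Definition dead_line : set R :=
  [set x | forall e, e \in H -> cos (x - center e) < cos rho].

Lemma coupling_dead x : dead_line x -> coupling (to_circle x) = 0.
Proof.
move=> dx; rewrite couplingE big1// => e eH.
by rewrite bump_eq0 ?mulr0//; apply: ltW; exact: dx.
Qed.

Lemma open_nbhs_lift x (U : set (circle R)) : open_nbhs (to_circle x) U ->
  exists2 e, 0 < e & forall y, `|y - x| < e -> U (to_circle y).
Proof. by move=> oU; apply: nbhs_to_circle; exact: open_nbhs_nbhs. Qed.

Lemma cos_shift_cvg (c x : R) : cos (y - c) @[y --> x] --> cos (x - c).
Proof.
have h : (y - c) @[y --> x] --> x - c.
  by apply: cvgB; [exact: cvg_id|exact: cvg_cst].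
exact: (cvg_comp (fun y => y - c) cos h (@continuous_cos R (x - c))).
Qed.

Lemma dead_line_open : open dead_line.
Proof.
rewrite openE => x dx; rewrite /interior.
suff : \forall y \near x, forall e, e \in H -> cos (y - center e) < cos rho.
  by [].
apply: (@filter_forall _ _
  (fun e (y : R) => e \in H -> cos (y - center e) < cos rho) (nbhs x)) => e.
have [eH|eH] := boolP (e \in H); last exact: nearW.
have h := cvgr_lt _ (@cos_shift_cvg (center e) x) _ (dx e eH).
near=> y => _; near: y; exact: h.
Unshelve. all: by end_near. Qed.

(** The closed arcs around the centres are live although the bumps vanish at
    their ends and at their midpoints, because those zeros are isolated from
    inside the arc. *)
Lemma dead_zone_coupling x : dead_zone coupling (to_circle x) <-> dead_line x.
Proof.
split.
  move=> [U /open_nbhs_lift[d d0 dU] U0] e eH; rewrite ltNge; apply/negP => c0.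
  have [m hm] := near_cos_le rho_pi c0.
  set s := _ + _ in hm.
  have r0 := rho_gt0.
  move: hm; rewrite ler_norml => /andP[hm1 hm2].
  (* The intersection of ]-rho, rho[ and ]s - d, s + d[ is a nonempty open
     interval, hence contains a nonzero point. *)
  have [s' [ss' s'r s'0]] :
      exists s', [/\ `|s' - s| < d, `|s'| < rho & s' != 0].
    pose a := Num.max (- rho) (s - d); pose b := Num.min rho (s + d).
    have [a1 a2] : - rho <= a /\ s - d <= a by rewrite !le_max !lexx orbT.
    have [b1 b2] : b <= rho /\ b <= s + d by rewrite !ge_min !lexx orbT.
    have ab : a < b.
      by rewrite gt_max !lt_min; apply/andP; split; apply/andP; split; lra.
    have good t : a < t < b -> `|t - s| < d /\ `|t| < rho.
      by move=> /andP[ta tb]; rewrite !ltr_norml; split; apply/andP; split; lra.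
    have [m0|m0] := eqVneq ((a + b) / 2) 0.
      have [|g1 g2] := good (b / 2); first by apply/andP; split; lra.
      by exists (b / 2); split => //; apply/negP => /eqP; lra.
    have [|g1 g2] := good ((a + b) / 2); first by apply/andP; split; lra.
    by exists ((a + b) / 2).
  have cs' : cos rho <= cos s' by apply: ltW; exact: cos_lt_near.
  pose y := x + (s' - s).
  have sE : cos (y - center e) = cos s' /\ bump rho (y - center e) = bump rho s'.
    rewrite -(cos_int m) -[in X in _ /\ X](bump_int _ m).
    by rewrite (_ : y - _ + _ = s') // /y /s; ring.
  have := U0 (to_circle y); rewrite (coupling_on eH) ?sE.1// sE.2 => /(_ _)/eqP.
  rewrite mulf_eq0 gt_eqF ?sg_gt0//= => h.
  have /negP := bump_near_neq0 rho_gt0 rho_le s'r s'0; apply; apply: h.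
  by apply: dU; rewrite /y addrC addKr.
move=> dx; have [d /= d0 hd] := dead_line_open dx.
exists [set to_circle y | y in dead_line]; last first.
  by move=> _ [y dy <-]; exact: coupling_dead.
split; last by exists x.
rewrite [open _]/(circle_open _) /circle_open.
rewrite (_ : _ @^-1` _ = dead_line); first exact: dead_line_open.
apply/seteqP; split => y /=; last by exists y.
move=> [y' dy' /to_circle_eq[m E]] e eH; have := dy' e eH.
by rewrite E addrAC cos_int.
Qed.

(** A nonzero constant value can only be taken where a single bump is active,
    and [bump_locally_constant] excludes it there. *)
Lemma locally_constant_coupling :
  locally_constant_set coupling = dead_zone coupling.
Proof.
apply/seteqP; split => z; last first.
  by move=> [U oU U0]; exists U => //; exists 0.
have [x _ ->] := to_circle_surj 0 z.
move=> [U oU [c Uc]]; exists U => //.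
suff c0 : c = 0 by move=> y /Uc; rewrite c0.
apply/eqP/negPn/negP => c0.
have [d d0 dU] := open_nbhs_lift oU.
have gx y : `|y - x| < d -> coupling (to_circle y) = c by move=> /dU/Uc.
have [e [eH ce]] : exists e, e \in H /\ cos rho < cos (x - center e).
  apply: contrapT => h; move: c0; rewrite -(gx x) ?subrr ?normr0//.
  rewrite couplingE big1 ?eqxx// => e eH; rewrite bump_eq0 ?mulr0// leNgt.
  by apply/negP => ce; apply: h; exists e.
have [d' /= d'0 hd'] := cvgr_gt _ (@cos_shift_cvg (center e) x) _ ce.
have dd0 : 0 < Num.min d d' by rewrite lt_min d0.
have h := @bump_locally_constant _ rho rho_gt0 rho_le (x - center e) _ (c / sg e) dd0.
have sg0 : sg e != 0 by rewrite gt_eqF ?sg_gt0.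
suff : c / sg e = 0 by move/eqP; rewrite mulf_eq0 (negbTE c0) invr_eq0 (negbTE sg0).
apply: h => y yx; pose t := y + center e.
have tx : `|t - x| < Num.min d d' by rewrite /t (_ : _ - x = y - (x - center e))//; ring.
have [t1 t2] : `|t - x| < d /\ `|t - x| < d' by move: tx; rewrite lt_min => /andP.
have ct : cos rho <= cos (t - center e) by apply: ltW; apply: hd'; rewrite /= distrC.
have := gx t t1; rewrite (coupling_on eH ct) => <-.
by rewrite mulrC mulKf// /t addrK.
Qed.

Lemma coupling_nonconstant e : e \in H -> ~ exists c, forall z, coupling z = c.
Proof.
move=> eH [c hc].
have : dead_zone coupling (to_circle (center e)).
  rewrite -locally_constant_coupling; exists setT; last by exists c.
  by split => //; exact: openT.
move=> /dead_zone_coupling/(_ e eH); rewrite subrr ltNge => /negP; apply.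
by rewrite cos0 cos_le1.
Qed.

(** All centres are mesh points, so each of the [2 K] mesh cells meets the dead
    set in an interval: an arc reaching into a cell enters through an endpoint.
    Each component therefore contains the image of one of finitely many
    connected pieces. *)
Lemma dead_zone_components :
  finite_set
    [set connected_component (dead_zone coupling) z | z in dead_zone coupling].
Proof.
pose cell (k : nat) :=
  [set x | dead_line x /\ mesh * k%:R <= x <= mesh * k.+1%:R].
pose arc k := [set to_circle x | x in cell k].
have cell_conn k : connected (cell k).
  apply/connected_intervalP => a b.
  move=> [da /andP[a1 a2]] [db /andP[b1 b2]] x /andP[ax xb].
  split; last by apply/andP; split; [exact: le_trans ax|exact: le_trans b2].
  move=> e eH; rewrite ltNge; apply/negP => cx.
  have [m hm] := near_cos_le rho_pi cx.
  have cE : center e - 2 * pi * m%:~R = mesh * (n e - (2 * K)%:Z * m)%:~R.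
    by rewrite two_pi_mesh /center intrB intrM mulrBr mulrA.
  have hm' : `|x - mesh * (n e - (2 * K)%:Z * m)%:~R| <= rho.
    by rewrite -cE opprB addrA addrAC [x + _ + _]addrAC in hm *.
  have cos_in y : `|y - mesh * (n e - (2 * K)%:Z * m)%:~R| <= rho ->
      dead_line y -> False.
    move=> hy dy; have := dy e eH; rewrite ltNge => /negP; apply.
    rewrite -(cos_int m (y - center e)); apply: (cos_le_near rho_pi).
    move: hy; rewrite -cE.
    by rewrite opprB addrA [y + _ - _]addrAC.
  set p := (n e - _)%R in hm' cos_in.
  (* The mesh point [mesh * p] is not inside the cell: it lies below [a] or above
     [b], which is then closer to it than [x] is. *)
  have m0 := mesh_gt0.
  have [pk|pk] := leP p k%:Z.
    apply: (cos_in a) => //.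
    have : mesh * p%:~R <= mesh * k%:R.
      by rewrite ler_pM2l// -[k%:R]/(k%:Z%:~R) ler_int.
    move: hm'; set q := mesh * p%:~R => hm' qk.
    by move: hm'; rewrite !ger0_norm; lra.
  apply: (cos_in b) => //.
  have : mesh * k.+1%:R <= mesh * p%:~R.
    by rewrite ler_pM2l// -[k.+1%:R]/(k.+1%:Z%:~R) ler_int -lez1D in pk *.
  move: hm'; set q := mesh * p%:~R => hm' qk.
  by move: hm'; rewrite !ler0_norm; lra.
have arc_conn k : connected (arc k).
  apply: connected_continuous_connected => //.
  exact/continuous_subspaceT/continuous_to_circle.
have arc_dead k : arc k `<=` dead_zone coupling.
  by move=> _ [x [dx _] <-]; exact/dead_zone_coupling.
pose F (k : 'I_(2 * K)) :=
  \bigcup_(z in arc k) connected_component (dead_zone coupling) z.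
apply: (@sub_finite_set _ _ (F @` setT)); last exact/finite_image/finite_finset.
move=> _ [z dz <-].
have [x /andP[x0 x1] zE] := to_circle_surj 0 z.
rewrite add0r two_pi_mesh in x1.
have [k [kK kx]] : exists k, (k < 2 * K)%N /\ mesh * k%:R <= x <= mesh * k.+1%:R.
  have m0 := mesh_gt0.
  have x0' : 0 <= x / mesh by rewrite divr_ge0// ltW.
  exists (Num.truncn (x / mesh)); have /andP[h1 h2] := truncn_itv x0'.
  split.
    rewrite -(ltr_nat R); apply: le_lt_trans h1 _.
    by rewrite ltr_pdivrMr// mulrC.
  by rewrite mulrC -ler_pdivlMr// h1/= mulrC -ler_pdivrMr// ltW.
have zk : arc k z.
  by exists x => //; split => //; apply/dead_zone_coupling; rewrite -zE.
exists (Ordinal kK) => //; rewrite /F/=.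
apply/seteqP; split => [w [z' az' hw]|w hw].
  suff <- : connected_component (dead_zone coupling) z' =
    connected_component (dead_zone coupling) z by [].
  apply: same_connected_component.
  exact: (connected_component_max az' (@arc_dead k) (arc_conn k)).
by exists z.
Qed.

Lemma coupling_function_coupling e : e \in H -> coupling_function coupling.
Proof.
move=> eH; split; [exact: coupling_smooth|exact: coupling_nonconstant eH|split].
  exact: dead_zone_components.
exact: locally_constant_coupling.
Qed.

Lemma coupling_local (tau : R) : 0 < tau -> exists2 d, 0 < d &
  forall e s, e \in S -> `|s| < d ->
    (e \in H -> `|coupling (to_circle (center e + s)) - sg e * s|
                  <= sg e * (tau * `|s|)) /\
    (e \notin H -> coupling (to_circle (center e + s)) = 0).
Proof.
move=> tau0; have [d d0 hd] := bump_linear rho_gt0 rho_le tau0.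
exists (Num.min d rho); first by rewrite lt_min d0 rho_gt0.
move=> e s eS; rewrite lt_min => /andP[sd sr].
have cs : cos rho <= cos (center e + s - center e).
  by rewrite addrC addKr; apply: ltW; exact: cos_lt_near.
split=> eH; last exact: coupling_off cs.
rewrite (coupling_on eH cs) -mulrBr normrM gtr0_norm ?sg_gt0//.
by rewrite ler_pM2l ?sg_gt0// [_ + s]addrC addrK; exact: hd.
Qed.

Lemma dead_zone_local : exists2 d, 0 < d &
  forall e s, e \in S -> `|s| < d ->
    dead_zone coupling (to_circle (center e + s)) <-> e \notin H.
Proof.
exists rho => // e s eS sr.
have cs : cos rho <= cos (center e + s - center e).
  by rewrite addrC addKr; apply: ltW; exact: cos_lt_near.
rewrite dead_zone_coupling; split.
  by move=> dx; apply/negP => eH; have := dx e eH; rewrite ltNge cs.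
move=> eH e' e'H; rewrite ltNge; apply/negP => c1.
have ee' : e' != e by apply: contraNneq eH => <-.
have [m1 h1] := near_cos_le rho_pi c1.
have := @center_sep e' e (- m1) (fintype.subsetP HS _ e'H) eS ee'.
rewrite (_ : _ + _ = s - (center e + s - center e' + 2 * pi * m1%:~R)); last first.
  by rewrite mulrNz; ring.
apply/negP; rewrite -ltNge (le_lt_trans (ler_normB _ _))//.
rewrite (lt_le_trans (ltr_leD sr h1))// /rho.
have a := mesh_gt0; lra.
Qed.

End Coupling.

(** * Phases with pairwise distinct differences *)

Lemma two_powers_le a b m : (a < m)%N -> (b < m)%N -> (2 ^ a + 2 ^ b <= 2 ^ m)%N.
Proof.
case: m => // m am bm; rewrite expnS mul2n -addnn.
by apply: leq_add; rewrite leq_exp2l.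
Qed.

(** The powers of two form a Sidon set: if the two sides shared no exponent, the
    side holding the largest one would exceed the other. *)
Lemma two_powers_sidon a b c d : (2 ^ a + 2 ^ d = 2 ^ c + 2 ^ b)%N ->
  a != b -> c != d -> a = c /\ b = d.
Proof.
move=> E ab cd.
have [ac|ac] := eqVneq a c.
  split=> //; move: E; rewrite ac => /addnI /eqP.
  by rewrite eqn_exp2l// => /eqP.
have db : d != b.
  apply: contraNneq ac => db; move: E; rewrite db => /addIn /eqP.
  by rewrite eqn_exp2l.
have pos x : (0 < 2 ^ x)%N by rewrite expn_gt0.
have := pos a; have := pos b; have := pos c; have := pos d.
have [da|ad] := leqP d a; have [cb|bc] := leqP c b.
- have [ba|ab'] := ltnP b a.
    by have := @two_powers_le c b a; lia.
  by have := @two_powers_le a d b; lia.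
- have [ca|ac'] := ltnP c a.
    by have := @two_powers_le c b a; lia.
  by have := @two_powers_le a d c; lia.
- have [bd|db'] := ltnP b d.
    by have := @two_powers_le c b d; lia.
  by have := @two_powers_le a d b; lia.
- have [cd'|dc] := ltnP c d.
    by have := @two_powers_le c b d; lia.
  by have := @two_powers_le a d c; lia.
Qed.

Definition off_diagonal N : digraph N := [set e : 'I_N * 'I_N | e.1 != e.2]%SET.

Definition gap N (e : 'I_N * 'I_N) : int := (2 ^ e.1)%N%:Z - (2 ^ e.2)%N%:Z.

(** The gaps are smaller than [2 ^ N] in absolute value, so that two of them
    which agree modulo [2 * 2 ^ N] agree. *)
Lemma gap_sep N (e e' : 'I_N * 'I_N) :
  e \in off_diagonal N -> e' \in off_diagonal N -> e != e' ->
  forall m : int, gap e - gap e' + (2 * 2 ^ N)%N%:Z * m != 0.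
Proof.
case: e e' => [i j] [k l]; rewrite !inE/= => ij kl ne m.
have bd (x : 'I_N) : (0 < 2 ^ x < 2 ^ N)%N by rewrite expn_gt0/= ltn_exp2l.
apply/negP => /eqP; rewrite /gap/= => E.
have m0 : m = 0.
  have := bd i; have := bd j; have := bd k; have := bd l; move: E; clear.
  move: (2 ^ i)%N (2 ^ j)%N (2 ^ k)%N (2 ^ l)%N (2 ^ N)%N => a b c d q; nia.
move/negP: ne; apply; apply/eqP.
have [] := @two_powers_sidon i j k l _ ij kl.
  by move: E; rewrite m0 mulr0 addr0; lia.
by move=> /val_inj -> /val_inj ->.
Qed.

Section Phases.
Variables (R : realType) (N : nat).

Definition phase (k : 'I_N) : R := mesh R (2 ^ N) * (2 ^ k)%:R.

Lemma center_gap (j k : 'I_N) :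
  center R (2 ^ N) (@gap N) (j, k) = phase j - phase k.
Proof. by rewrite /center /phase /gap/= intrB mulrBr. Qed.

(** Because the phase differences of all ordered pairs are distinct on the circle,
    the interaction of each pair can be prescribed to first order independently
    of the others: dead off [H], with slope [sg j k] on [H]. *)
Lemma exists_coupling (H : digraph N) (sg : 'I_N -> 'I_N -> R) (tau : R) :
  H != finset.set0 -> H \subset off_diagonal N ->
  (forall j k, (j, k) \in H -> 0 < sg j k) -> 0 < tau ->
  exists2 g : circle R -> R, coupling_function g &
  exists2 d, 0 < d & forall j k s, j != k -> `|s| < d ->
   [/\ (j, k) \in H -> `|g (to_circle (phase j - phase k + s)) - sg j k * s|
          <= sg j k * (tau * `|s|),
       (j, k) \notin H -> g (to_circle (phase j - phase k + s)) = 0 &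
       dead_zone g (to_circle (phase j - phase k + s)) <-> (j, k) \notin H].
Proof.
move=> /finset.set0Pn[e eH] HS sg0 tau0.
have K0 : (0 < 2 ^ N)%N by rewrite expn_gt0.
have sg0' e' : e' \in H -> 0 < sg e'.1 e'.2 by case: e' => j k; exact: sg0.
exists (coupling (2 ^ N) (@gap N) H (fun e => sg e.1 e.2)).
  exact: (coupling_function_coupling K0 (@gap_sep N) HS sg0' eH).
have [d1 d10 h1] := coupling_local K0 (@gap_sep N) HS sg0' tau0.
have [d2 d20 h2] := dead_zone_local K0 (@gap_sep N) HS sg0'.
exists (Num.min d1 d2); first by rewrite lt_min d10.
move=> j k s jk; rewrite lt_min => /andP[s1 s2]; rewrite -center_gap.
have jkS : (j, k) \in off_diagonal N by rewrite inE.
by have [] := h1 _ _ jkS s1; split => //; exact: h2.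
Qed.
End Phases.

(** * Dissipation along a diverging tree *)

Section Tree.
Variables (R : realType) (N : nat) (D : digraph N).
Hypothesis Dconn : weakly_connected D.
Variable r : 'I_N.
Hypothesis Dr : in_degree D r = 0%N.
Hypothesis Dk : forall k, k != r -> in_degree D k = 1%N.

Definition parent (k : 'I_N) : 'I_N := odflt k [pick j | (j, k) \in D].

Lemma root_in j : ((j, r) \in D) = false.
Proof. by have /card0_eq/(_ j) := Dr; rewrite !inE. Qed.

Lemma parent_root : parent r = r.
Proof. by rewrite /parent; case: pickP => //= j; rewrite root_in. Qed.

Lemma parentP j k : k != r -> ((j, k) \in D) = (j == parent k).
Proof.
move=> kr; have /mem_card1[i hi] := Dk kr.
have E j' : ((j', k) \in D) = (j' == i) by have := hi j'; rewrite !inE.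
rewrite E; congr (_ == _); rewrite /parent.
by case: pickP => [j'/=|/(_ i)]; rewrite E ?eqxx// => /eqP.
Qed.

(** The vertices whose line of ancestors ends at the root are closed under the
    edges of [D] in both directions, hence exhaust the connected graph. *)
Lemma ancestors_reach k : exists n, iter n parent k == r.
Proof.
pose reach := [pred k | `[< exists n, iter n parent k == r >]].
suff : fingraph.closed (fun a b => ((a, b) \in D) || ((b, a) \in D)) reach.
  move=> /closed_connect/(_ _ _ (Dconn k r)); rewrite !inE.
  have -> : `[< exists n, iter n parent r == r >] by apply/asboolP; exists 0%N.
  by move/asboolP.
have step a b : (a, b) \in D -> (a \in reach) = (b \in reach).
  have [->|br] := eqVneq b r; first by rewrite root_in.
  rewrite parentP// => /eqP ->; rewrite !inE; apply/asboolP/asboolP => -[n].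
    by move=> hn; exists n.+1; rewrite iterSr.
  case: n => [/=|n]; first by rewrite (negbTE br).
  by rewrite iterSr => hn; exists n.
by move=> a b /orP[/step|/step/esym].
Qed.

Definition depth k : nat := ex_minn (ancestors_reach k).

Lemma depth_parent k : k != r -> depth k = (depth (parent k)).+1.
Proof.
move=> kr; rewrite /depth; case: ex_minnP => n hn minn; case: ex_minnP => m hm minm.
apply/eqP; rewrite eqn_leq; apply/andP; split; first by apply: minn; rewrite iterSr.
case: n hn {minn} => [/=|n hn]; first by rewrite (negbTE kr).
by rewrite ltnS; apply: minm; rewrite -iterSr.
Qed.

(* Each vertex has fewer than [N.+1] children, so that the ratio [q] makes the
   total weight of the children at most half that of their parent. *)
Let q : R := (2 * N.+1%:R)^-1.

Definition weight k : R := q ^+ depth k.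

Let q_gt0 : 0 < q. Proof. by rewrite invr_gt0 mulr_gt0// ltr0n. Qed.

Lemma weight_gt0 k : 0 < weight k. Proof. exact: exprn_gt0. Qed.

Let q_le1 : q <= 1.
Proof. by rewrite invf_le1 ?mulr_gt0 ?ltr0n// -natrM ler1n. Qed.

Lemma weight_le1 k : weight k <= 1.
Proof. by apply: exprn_ile1 => //; exact: ltW. Qed.

Lemma children_weight l :
  \sum_(k | (k != r) && (parent k == l)) weight k <= weight l / 2.
Proof.
have -> : \sum_(k | (k != r) && (parent k == l)) weight k =
    \sum_(k | (k != r) && (parent k == l)) q * weight l.
  by apply: eq_bigr => k /andP[kr /eqP <-]; rewrite /weight depth_parent// exprS.
rewrite big_const iter_addr_0 mulrC -mulrnAr.
rewrite ler_pM2l ?weight_gt0//.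
have h : (#|[pred k | (k != r) && (parent k == l)]| <= N.+1)%N.
  by apply: leq_trans (max_card _) _; rewrite card_ord leqnSn.
apply: (@le_trans _ _ (q *+ N.+1)); first by apply: ler_wpMn2l h; exact: ltW.
by rewrite -[q *+ _]mulr_natr /q invfM mulfVK ?pnatr_eq0.
Qed.

(** By [w_p w_k - w_k^2 <= (w_p^2 - w_k^2) / 2], each vertex is damped by its own
    weight and excited only by its children, whose total weight is at most half
    of it. *)
Lemma tree_dissipation (w : 'I_N -> R) : w r = 0 ->
  \sum_k w k * (weight k * (w (parent k) - w k)) <= - (\sum_k weight k * w k ^+ 2) / 4.
Proof.
move=> wr.
have h1 : \sum_k w k * (weight k * (w (parent k) - w k)) <=
   2^-1 * (\sum_(k | k != r) weight k * w (parent k) ^+ 2)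
   - 2^-1 * (\sum_k weight k * w k ^+ 2).
  rewrite (bigID (fun k => k != r)) /= [X in _ + X]big1 ?addr0; last first.
    by move=> k /negPn/eqP->; rewrite wr mul0r.
  have -> : \sum_k weight k * w k ^+ 2 = \sum_(k | k != r) weight k * w k ^+ 2.
    rewrite (bigID (fun k => k != r)) /= [X in _ + X]big1 ?addr0// => k /negPn/eqP->.
    by rewrite wr expr0n mulr0.
  rewrite !mulr_sumr -sumrB; apply: ler_sum => k _.
  have := weight_gt0 k; move: (weight k) (w k) (w (parent k)) => c x y c0.
  have : 0 <= c * (y - x) ^+ 2 by rewrite mulr_ge0 ?sqr_ge0 ?ltW.
  by rewrite sqrrB; lra.
apply: le_trans h1 _.
have h2 : \sum_(k | k != r) weight k * w (parent k) ^+ 2 <=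
    2^-1 * \sum_k weight k * w k ^+ 2.
  rewrite (partition_big parent predT)//= mulr_sumr; apply: ler_sum => l _.
  have -> :
    \sum_(k | (k != r) && (parent k == l)) weight k * w (parent k) ^+ 2 =
    (\sum_(k | (k != r) && (parent k == l)) weight k) * w l ^+ 2.
    by rewrite mulr_suml; apply: eq_bigr => k /andP[_ /eqP->].
  rewrite [X in _ <= X]mulrA ler_wpM2r ?sqr_ge0// [X in _ <= X]mulrC.
  exact: children_weight.
lra.
Qed.

Definition weight_min : R := q ^+ (\max_k depth k).

Lemma weight_min_gt0 : 0 < weight_min. Proof. exact: exprn_gt0. Qed.

Lemma weight_min_le k : weight_min <= weight k.
Proof.
apply: ler_wiXn2l => //; first exact: ltW.
exact: (leq_bigmax (F := depth)).
Qed.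

(** The perturbation [e] stands for the edges outside the tree and for the
    nonlinearity. It contributes at most a multiple of [eta * (\sum_k |w k|)^2],
    where [w k = x k - x r], and Cauchy-Schwarz bounds this by the dissipation
    of the tree once [eta] is small. *)
Lemma perturbed_dissipation :
  exists2 eta : R, 0 < eta & exists2 kappa : R, 0 < kappa &
  forall x e : 'I_N -> R,
    (forall k, `|e k| <= eta * \sum_j `|x j - x k|) ->
    \sum_k (x k - x r) * ((weight k * (x (parent k) - x k) + e k) - e r) <=
    - kappa * \sum_k (x k - x r) ^+ 2.
Proof.
have M0 := weight_min_gt0.
pose n : R := N.+1%:R; have n0 : 0 < n by rewrite ltr0n.
(* The tree yields [weight_min / 4]; this [eta] lets the perturbation consume at
   most [weight_min / 16] of it. *)
exists (weight_min / (32 * n ^+ 2)).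
  by rewrite divr_gt0// mulr_gt0// exprn_gt0.
set eta := _ / _.
exists (weight_min / 8); first by rewrite divr_gt0.
move=> x e he; pose w k := x k - x r.
pose Q := \sum_k w k ^+ 2; pose A := \sum_k `|w k|.
have wr : w r = 0 by rewrite /w subrr.
have A0 : 0 <= A by exact: sumr_ge0.
have Q0 : 0 <= Q by apply: sumr_ge0 => k _; exact: sqr_ge0.
have eta0 : 0 <= eta by rewrite ltW// divr_gt0// mulr_gt0// exprn_gt0.
have wA k : `|w k| <= A by rewrite /A (bigD1 k)//= lerDl sumr_ge0.
have Nn : N%:R <= n - 1 :> R by rewrite /n -natr1 addrK.
have he' k : `|e k| <= eta * (n * A).
  apply: le_trans (he k) _; rewrite ler_wpM2l//.
  apply: (@le_trans _ _ (\sum_j (`|w j| + `|w k|))).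
    apply: ler_sum => j _; rewrite (_ : x j - x k = w j - w k); last by rewrite /w; ring.
    exact: ler_normB.
  rewrite big_split/= sumr_const card_ord -/A -mulr_natr.
  have := wA k; have : 0 <= N%:R :> R by rewrite ler0n.
  move: Nn (normr_ge0 (w k)); move: (`|w k|) (N%:R) => a b; nra.
have AQ : A ^+ 2 <= n * Q.
  have : 0 <= \sum_i \sum_j (`|w i| - `|w j|) ^+ 2.
    by apply: sumr_ge0 => i _; apply: sumr_ge0 => j _; exact: sqr_ge0.
  have -> : \sum_i \sum_j (`|w i| - `|w j|) ^+ 2 = 2 * (N%:R * Q - A ^+ 2).
    have -> : \sum_i \sum_j (`|w i| - `|w j|) ^+ 2 =
        \sum_(i < N) (\sum_(j < N) (w i ^+ 2) - (2 * `|w i|) * A + Q).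
      apply: eq_bigr => i _; rewrite /A /Q mulr_sumr -sumrB -big_split/=.
      apply: eq_bigr => j _; rewrite sqrrB !real_normK ?num_real//; ring.
    have t1 (c : R) : \sum_(i < N) c = N%:R * c.
      by rewrite sumr_const card_ord -[_ *+ N]mulr_natl.
    have t2 : \sum_i (2 * `|w i|) * A = 2 * A * A by rewrite -mulr_suml -mulr_sumr.
    by rewrite !big_split/= sumrN t2 exchange_big/= !t1 -/Q expr2; ring.
  have : N%:R * Q <= n * Q by rewrite ler_wpM2r// ler_nat.
  lra.
have h1 := tree_dissipation wr.
have -> :
  \sum_k (x k - x r) * ((weight k * (x (parent k) - x k) + e k) - e r) =
  \sum_k w k * (weight k * (w (parent k) - w k)) + \sum_k w k * (e k - e r).
  by rewrite -big_split/=; apply: eq_bigr => k _; rewrite /w; ring.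
have h2 : \sum_k w k * (e k - e r) <= A * (2 * (eta * (n * A))).
  rewrite [leRHS]mulr_suml; apply: ler_sum => k _; apply: le_trans (ler_norm _) _.
  rewrite normrM ler_wpM2l// (le_trans (ler_normB _ _))//.
  by have := he' k; have := he' r; lra.
have h3 : weight_min * Q <= \sum_k weight k * w k ^+ 2.
  rewrite /Q mulr_sumr; apply: ler_sum => k _.
  apply: ler_wpM2r; first exact: sqr_ge0.
  exact: weight_min_le.
rewrite -/Q.
have h4 : A * (2 * (eta * (n * A))) <= weight_min / 16 * Q.
  have -> : A * (2 * (eta * (n * A))) = weight_min / (16 * n) * A ^+ 2.
    by rewrite /eta; field; rewrite gt_eqF.
  have -> : weight_min / 16 * Q = weight_min / (16 * n) * (n * Q).
    by field; rewrite gt_eqF.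
  by rewrite ler_wpM2l// divr_ge0 ?ltW// mulr_gt0.
have : 0 <= weight_min * Q by rewrite mulr_ge0// ltW.
move: h1 h2 h3 h4.
move: (\sum_k w k * (weight k * _)) (\sum_k w k * (e k - e r)).
move: (\sum_k weight k * w k ^+ 2).
move: (A * _) => a b c d; lra.
Qed.
End Tree.

(** * Tubes around an orbit of phase shifts *)

(** A point of the torus is described by its displacement [x] from the reference
    phases [phi], unique up to multiples of [2 pi] in each coordinate. *)
Section Tube.
Variables (R : realType) (N : nat) (r : 'I_N) (phi : 'I_N -> R).
Implicit Types x y : 'I_N -> R.

Definition dev x : R := \sum_k (x k - x r) ^+ 2.

Definition wrap x : 'rV[circle R]_N := \row_k to_circle (phi k + x k).

Definition tube (v : R) : set 'rV[circle R]_N :=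
  [set wrap x | x in [set x | dev x < v]].

Lemma dev_ge0 x : 0 <= dev x.
Proof. by apply: sumr_ge0 => k _; exact: sqr_ge0. Qed.

Lemma dev_coord x k : (x k - x r) ^+ 2 <= dev x.
Proof. by rewrite /dev (bigD1 k)//= lerDl sumr_ge0// => j _; exact: sqr_ge0. Qed.

Lemma dev_shift x c : dev (fun k => x k + c) = dev x.
Proof. by apply: eq_bigr => k _; congr (_ ^+ 2); ring. Qed.

Lemma dev_scale x s : dev (fun k => x r + s * (x k - x r)) = s ^+ 2 * dev x.
Proof.
rewrite /dev mulr_sumr; apply: eq_bigr => k _.
by rewrite -exprMn; congr (_ ^+ 2); ring.
Qed.

Lemma dev_cst0 : dev (fun=> 0) = 0.
Proof. by rewrite /dev big1// => k _; rewrite subrr expr0n. Qed.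

Lemma norm_le1D (a : R) : `|a| <= 1 + a ^+ 2.
Proof.
rewrite -[a ^+ 2]real_normK ?num_real//; move: (`|a|) => b.
have := sqr_ge0 (b - 2^-1); nra.
Qed.

Lemma sqr_lt_norm (a d : R) : 0 < d -> a ^+ 2 < d ^+ 2 -> `|a| < d.
Proof.
move=> d0 h; rewrite -(@ltr_pXn2r _ 2) ?nnegrE ?(ltW d0)//.
by rewrite real_normK ?num_real.
Qed.

(** Continuity of [dev] has to be uniform on sublevel sets, since a point of the
    torus has infinitely many lifts. *)
Lemma dev_perturb (v v' : R) : v < v' -> exists2 e, 0 < e &
  forall x y, dev x <= v -> (forall k, `|y k - x k| < e) -> dev y < v'.
Proof.
move=> vv'.
have [v0|v0] := ltP v 0.
  by exists 1 => // x y /le_lt_trans/(_ v0); rewrite ltNge dev_ge0.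
pose C : R := 4 * v + 8; have C0 : 0 < C by rewrite /C; lra.
have n0 : 0 < N.+1%:R :> R by rewrite ltr0n.
have d0 : 0 < (v' - v) / (N.+1%:R * C) by rewrite divr_gt0 ?subr_gt0// mulr_gt0.
exists (Num.min 1 ((v' - v) / (N.+1%:R * C))); first by rewrite lt_min ltr01.
set e := Num.min _ _.
have [e1 e2] : e <= 1 /\ e <= (v' - v) / (N.+1%:R * C) by rewrite !ge_min !lexx orbT.
have e0 : 0 < e by rewrite lt_min ltr01.
move=> x y xv xy.
have h k : (y k - y r) ^+ 2 <= (x k - x r) ^+ 2 + e * C.
  have w1 := norm_le1D (x k - x r); have w2 := dev_coord x k.
  have -> : y k - y r = (x k - x r) + ((y k - x k) - (y r - x r)) by ring.
  have hd : `|(y k - x k) - (y r - x r)| <= 2 * e.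
    by rewrite (le_trans (ler_normB _ _))//; have := xy k; have := xy r; lra.
  move: w1 w2 hd; set w := x k - x r; set d := _ - _ => w1 w2 hd.
  have : w * d <= (1 + v) * (2 * e).
    apply: le_trans (ler_norm _) _; rewrite normrM; apply: ler_pM => //.
    by apply: le_trans w1 _; lra.
  have : d ^+ 2 <= 4 * e.
    rewrite -[d ^+ 2]real_normK ?num_real//; move: hd (normr_ge0 d).
    by move: (`|d|) => b; nra.
  by rewrite [(w + d) ^+ 2]sqrrD /C; move: (d ^+ 2) (w ^+ 2) (w * d) => p q s; lra.
apply: (@le_lt_trans _ _ (v + N%:R * (e * C))).
  apply: (@le_trans _ _ (dev x + \sum_(k < N) e * C)).
    by rewrite /dev -big_split/=; apply: ler_sum => k _; exact: h.
  by rewrite sumr_const card_ord -[_ *+ N]mulr_natl lerD2r.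
have : e * C * N.+1%:R <= v' - v.
  by move: e2; rewrite ler_pdivlMr ?mulr_gt0// [_ * C]mulrC mulrA.
have : 0 < e * C by rewrite mulr_gt0.
rewrite -natr1; move: (e * C) (N%:R) => a b; lra.
Qed.

Lemma wrap_int x (m : 'I_N -> int) : wrap (fun k => x k + 2 * pi * (m k)%:~R) = wrap x.
Proof. by apply/rowP => k; rewrite !mxE addrA to_circle_int. Qed.

Lemma wrap_eq x y : wrap x = wrap y ->
  exists m : 'I_N -> int, x = fun k => y k + 2 * pi * (m k)%:~R.
Proof.
move=> /rowP E.
have /choice[m mE] : forall k, exists m : int, x k = y k + 2 * pi * m%:~R.
  move=> k; have := E k; rewrite !mxE => /to_circle_eq[m hm]; exists m.
  by apply: (addrI (phi k)); rewrite hm addrA.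
by exists m; apply/funext.
Qed.

Lemma wrap_surj (theta : 'rV[circle R]_N) : exists x, theta = wrap x.
Proof.
have /choice[x xE] : forall k, exists a : R, theta 0 k = to_circle (phi k + a).
  move=> k; have [a _ ->] := to_circle_surj 0 (theta 0 k).
  by exists (a - phi k); rewrite addrC subrK.
by exists x; apply/rowP => k; rewrite mxE.
Qed.

Lemma wrap_nbhs x (e : R) : 0 < e ->
  nbhs (wrap x) [set wrap y | y in [set y | forall k, `|y k - x k| < e]].
Proof.
move=> e0.
exists (fun _ k => [set to_circle z | z in [set z | `|z - (phi k + x k)| < e]]).
  by move=> i k; rewrite mxE; exact: to_circle_nbhs.
move=> theta /= h.
have /choice[z zE] : forall k, exists z : R,
    `|z - (phi k + x k)| < e /\ to_circle z = theta 0 k.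
  by move=> k; have [z h1 h2] := h 0 k; exists z.
exists (fun k => z k - phi k).
  by move=> k /=; have [] := zE k; rewrite opprD addrA.
by apply/rowP => k; rewrite mxE addrC subrK; have [] := zE k.
Qed.

Lemma nbhs_wrap x (U : set 'rV[circle R]_N) : nbhs (wrap x) U ->
  exists2 e, 0 < e & forall y, (forall k, `|y k - x k| < e) -> U (wrap y).
Proof.
move=> [P hP PU].
have /choice[e eE] : forall k, exists e : R, 0 < e /\
    forall z, `|z - (phi k + x k)| < e -> P 0 k (to_circle z).
  move=> k; have := hP 0 k; rewrite mxE => /nbhs_to_circle[e e0 he]; by exists e.
exists (\big[Num.min/1]_k e k).
  by apply: lt_bigmin => // k _; have [] := eE k.
move=> y hy; apply: PU => i k; rewrite ord1 mxE; have [_ h] := eE k.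
apply: h; rewrite opprD addrACA subrr add0r; apply: lt_le_trans (hy k) _.
exact: bigmin_le.
Qed.

Lemma tube_open v : open (tube v).
Proof.
rewrite openE => _ [x xv <-]; have [e e0 he] := dev_perturb xv.
rewrite /interior; apply: filterS (wrap_nbhs x e0) => _ [y hy <-].
by exists y => //; exact: he hy.
Qed.

Lemma tube_le v v' : v <= v' -> tube v `<=` tube v'.
Proof. by move=> vv' _ [x xv <-]; exists x => //=; exact: lt_le_trans vv'. Qed.

(** A point of the tube close to [wrap x] has a lift of small [dev] which may
    be far from [x]; translating [x] by the same multiples of [2 pi] brings it
    close again, and [dev_perturb] applies. *)
Lemma closure_tube v v' : v < v' -> closure (tube v) `<=` tube v'.
Proof.
move=> vv' theta; have [x ->] := wrap_surj theta.
have [e e0 he] := dev_perturb vv'.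
move=> /(_ _ (wrap_nbhs x e0))[_ [[y yv <-] [z zx /wrap_eq[m zE]]]].
rewrite -(wrap_int x (fun k => - m k)); eexists; last by [].
apply: (he y); first exact: ltW.
move=> k; have := zx k; rewrite distrC (_ : x k + _ - y k = x k - z k) 1?distrC//.
by rewrite zE mulrNz; ring.
Qed.

(** Points with [dev x = v] are approached by contracting [x] towards [x r]. *)
Lemma sublevel_closure v x : 0 < v -> dev x <= v -> closure (tube v) (wrap x).
Proof.
move=> v0 xv U /nbhs_wrap[e e0 he].
have v1 : 0 < 2 * (1 + v) by lra.
pose t := Num.min (1 / 2) (e / (2 * (1 + v))).
have t0 : 0 < t by rewrite lt_min !divr_gt0.
have [t1 t2] : t <= 1 / 2 /\ t <= e / (2 * (1 + v)) by rewrite !ge_min !lexx orbT.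
exists (wrap (fun k => x r + (1 - t) * (x k - x r))); split.
  exists (fun k => x r + (1 - t) * (x k - x r)) => //=; rewrite dev_scale.
  apply: (@le_lt_trans _ _ ((1 - t) ^+ 2 * v)); first by rewrite ler_wpM2l// sqr_ge0.
  by rewrite gtr_pMl// expr_lt1//; lra.
apply: he => k; rewrite (_ : _ - x k = - (t * (x k - x r))); last by ring.
rewrite normrN normrM gtr0_norm//.
have := norm_le1D (x k - x r); have := dev_coord x k.
move: t2; rewrite ler_pdivlMr//; move: (normr_ge0 (x k - x r)).
move: (`|_|) ((x k - x r) ^+ 2) => a b a0 h1 h2 h3.
have : t * a <= t * (1 + v) by rewrite ler_pM2l//; lra.
lra.
Qed.

(** By compactness, [U] contains everything at distance less than some [d] from
    the points with [dev x <= v], and contracting a point of a slightly larger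
    tube towards its root coordinate moves it by less than [d]. *)
Lemma tube_basis v U : 0 < v -> set_nbhs (closure (tube v)) U ->
  exists2 v', v < v' & tube v' `<=` U.
Proof.
move=> v0 hU.
(* Up to a phase shift by a multiple of [2 pi], every point with [dev <= v] has
   its coordinates in [-L, L]. *)
pose L : R := 2 * pi + 1 + v.
pose K : set 'rV[R]_N := [set z | forall k, (`[- L, L]%classic : set R) (z ord0 k)].
have cK : compact K.
  apply: (@rV_compact _ _ (fun=> `[(- L), L]%classic)) => _.
  exact: segment_compact.
pose P (d : R) (z : 'rV[R]_N) := dev (z ord0) <= v ->
  forall y, (forall k, `|y k - z ord0 k| < d) -> U (wrap y).
have near_ball (z : 'rV[R]_N) (e : R) : 0 < e ->
    \forall z' \near z, forall k, `|(z' : 'rV[R]_N) ord0 k - z ord0 k| < e.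
  move=> e0; apply: filterS (nbhsx_ballx z e e0) => z' [_ h] k.
  by have := h ord0 k; rewrite /ball/= distrC.
have cover : forall z, K z -> \forall z' \near z & d \near (0:R)^'+, P d z'.
  move=> z _; have [zv|zv] := leP (dev (z ord0)) v.
    have /nbhs_wrap[e e0 he] := hU _ (sublevel_closure v0 zv).
    have e20 : 0 < e / 2 by rewrite divr_gt0.
    exists ([set z' : 'rV[R]_N | forall k, `|z' ord0 k - z ord0 k| < e / 2],
            [set d | d < e / 2]).
      by split; [exact: near_ball|exact: (nbhs_right_lt e20)].
    move=> [z' d] /= [hz' hd] _ y hy; apply: he => k.
    rewrite (_ : y k - z ord0 k =
      (y k - z' ord0 k) + (z' ord0 k - z ord0 k)); last by ring.
    rewrite (le_lt_trans (ler_normD _ _))//; have := hy k; have := hz' k; lra.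
  have [e e0 he] := dev_perturb zv.
  (* Near [z] there is no point with [dev <= v]. *)
  exists ([set z' : 'rV[R]_N | forall k, `|z' ord0 k - z ord0 k| < e], setT).
    by split; [exact: near_ball|exact: filterT].
  move=> [z' d] /= [hz' _] z'v; exfalso.
  have := he _ (z ord0) z'v; rewrite ltxx => /(_ _)/notF; apply => k.
  by rewrite distrC.
have hK :=
  proj1 (compact_near_coveringP K) cK R ((0 : R)^'+) P _ cover.
have [d [d0 hd]] : exists d, 0 < d /\ K `<=` P d.
  near (0 : R)^'+ => d; exists d.
  by split; near: d; [exact: nbhs_right_gt|exact: hK].
have v1 : 0 < 2 * (1 + 4 * v) by lra.
pose t := Num.min (1 / 2) (d / (2 * (1 + 4 * v))).
have t0 : 0 < t by rewrite lt_min !divr_gt0.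
have [t1 t2] : t <= 1 / 2 /\ t <= d / (2 * (1 + 4 * v)) by rewrite !ge_min !lexx orbT.
have s0 : 0 < (1 - t) ^+ 2 by rewrite exprn_gt0//; lra.
(* [1 - t] is the contraction ratio; [t <= 1 / 2] keeps the larger tube below
   level [4 * v], which bounds the coordinates uniformly. *)
exists (v / (1 - t) ^+ 2).
  by rewrite ltr_pdivlMr// gtr_pMr// expr_lt1//; lra.
move=> _ [y /= yv <-].
have [m /andP[m0 m1]] := mod_two_pi 0 (y r).
rewrite -(wrap_int y (fun=> m)).
set y' := fun k => _.
have y'v : (1 - t) ^+ 2 * dev y' <= v.
  by rewrite dev_shift mulrC -ler_pdivlMr// ltW.
have y'4 : dev y' <= 4 * v.
  have : 1 / 4 <= (1 - t) ^+ 2 by nra.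
  have := dev_ge0 y'; move: y'v; move: ((1 - t) ^+ 2) (dev y') => a b; nra.
pose z k := y' r + (1 - t) * (y' k - y' r).
have zv : dev z <= v by rewrite dev_scale.
have z_row : (\row_k z k : 'rV[R]_N) ord0 = z by apply/funext => k; rewrite mxE.
apply: (hd (\row_k z k)).
- move=> k /=; rewrite mxE in_itv/= -ler_norml.
  have zr : z r = y' r by rewrite /z subrr mulr0 addr0.
  rewrite (_ : z k = z r + (z k - z r)); last by ring.
  rewrite (le_trans (ler_normD _ _))// zr ger0_norm//.
  have := norm_le1D (z k - z r); have := dev_coord z k; rewrite zr /L.
  by move: m1; rewrite add0r -/(y' r); lra.
- by rewrite z_row.
- move=> k; rewrite mxE /z (_ : y' k - _ = t * (y' k - y' r)); last by ring.
  rewrite normrM gtr0_norm//.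
  have := norm_le1D (y' k - y' r); have := dev_coord y' k.
  move: t2; rewrite ler_pdivlMr//.
  move: (`|_|) ((y' k - y' r) ^+ 2) => a b h1 h2 h3.
  have : t * a <= t * (1 + 4 * v) by rewrite ler_pM2l//; lra.
  lra.
Unshelve. all: by end_near. Qed.

End Tube.

(** * Trajectories contract the tubes *)

Section Decay.
Variable R : realType.

(** The differential inequality is only known below the level [v0]. At the first
    time when [V] reached [v0], the mean value theorem would give [V <= V 0 < v0];
    hence the inequality holds for all positive times and [V exp (kappa t)]
    decreases. *)
Lemma decay (V V' : R -> R) (v0 kappa : R) : 0 <= kappa ->
  (forall t : R, is_derive t 1 V (V' t)) -> (forall t, 0 <= V t) -> V 0 < v0 ->
  (forall t, V t < v0 -> V' t <= - kappa * V t) ->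
  forall t, 0 <= t -> V t <= V 0 * expR (- kappa * t).
Proof.
move=> k0 dV V0 Vv0 V'le.
have cV (t : R) : {for t, continuous V}.
  by apply/differentiable_continuous/derivable1_diffP; have [] := dV t.
have stay t : 0 <= t -> V t < v0.
  move=> t0; rewrite ltNge; apply/negP => tv.
  pose S : set R := [set s | 0 <= s /\ v0 <= V s].
  have infS : has_inf S.
    by split; [exists t|exists 0 => s []].
  pose m := inf S.
  have m0 : 0 <= m by apply: lb_le_inf; [exists t|move=> s []].
  have Vm : v0 <= V m.
    rewrite leNgt; apply/negP => Vm.
    have [e /= e0 he] := cvgr_lt _ (cV m) _ Vm.
    have [s [s0 sv] sm] := inf_adherent e0 infS.
    have ms : m <= s by apply: ge_inf => //; exact: infS.2.
    have : V s < v0.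
      by apply: he; rewrite /= distrC ger0_norm ?subr_ge0// ltrBlDl.
    by rewrite ltNge sv.
  have m_gt0 : 0 < m.
    rewrite lt_neqAle m0 andbT; apply/eqP => mE.
    by move: Vm; rewrite -mE leNgt Vv0.
  have [c /andP[c0 cm] cE] :=
    MVT m_gt0 (fun s _ => dV s) (continuous_subspaceT cV).
  have : V c < v0.
    rewrite ltNge; apply/negP => cv.
    have : m <= c by apply: ge_inf; [exact: infS.2|split => //; exact: ltW].
    by rewrite leNgt; rewrite bnd_simp in cm; rewrite cm.
  move=> /V'le h; have : V' c <= 0.
    by apply: le_trans h _; rewrite mulNr oppr_le0 mulr_ge0.
  move=> h'; have : V m - V 0 <= 0 by rewrite cE subr0 mulr_le0_ge0.
  by rewrite subr_le0 => /le_lt_trans/(_ Vv0); rewrite ltNge Vm.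
move=> t t0.
pose E (s : R) := V s * expR (kappa * s).
have dE (s : R) : is_derive s 1 E (expR (kappa * s) * (V' s + kappa * V s)).
  have d1 : is_derive s 1 (fun s : R => kappa * s) (kappa * 1).
    exact: (@is_deriveZ _ _ _ id kappa s 1 1 (is_derive_id _ _)).
  have d2 := @is_derive1_comp _ expR (fun s : R => kappa * s) s _ _
     (is_derive_expR _) d1.
  have d3 := @is_deriveM _ _ _ _ _ _ _ _ (dV s) d2.
  apply: (is_derive_eq d3).
  by rewrite /GRing.scale/=; ring.
have cE : continuous E.
  by move=> s; apply/differentiable_continuous/derivable1_diffP; have [] := dE s.
have [c /andP[c0 ct] hc] :=
  MVT_segment t0 (fun s _ => dE s) (continuous_subspaceT cE).
rewrite !bnd_simp in c0 ct.
have : E t - E 0 <= 0.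
  rewrite hc subr0 mulr_le0_ge0// mulr_ge0_le0 ?expR_ge0//.
  by have := V'le c (stay c c0); lra.
rewrite subr_le0 /E mulr0 expR0 mulr1 => h.
by rewrite mulNr expRN ler_pdivlMr ?expR_gt0.
Qed.

Lemma decay_eventually (v kappa e : R) : 0 < kappa -> 0 < e ->
  \forall t \near +oo, v * expR (- kappa * t) < e.
Proof.
move=> k0 e0; near=> t.
have t0 : 0 < t by near: t; apply: nbhs_pinfty_gt; exact: num_real.
rewrite mulNr expRN ltr_pdivrMr ?expR_gt0//.
have kt : 1 + kappa * t <= expR (kappa * t) by exact: expR_ge1Dx.
have h : v / (e * kappa) < t by near: t; apply: nbhs_pinfty_gt; exact: num_real.
rewrite ltr_pdivrMr ?mulr_gt0// in h.
apply: lt_le_trans h _; rewrite mulrC -mulrA ler_pM2l//; lra.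
Unshelve. all: by end_near. Qed.

Variables (N : nat) (r : 'I_N) (phi : 'I_N -> R).

Lemma is_derive_dev (y : R -> 'I_N -> R) (F : 'I_N -> R) (t : R) :
  (forall k, is_derive t 1 (fun s => y s k) (F k)) ->
  is_derive t 1 (fun s => dev r (y s))
    (2 * \sum_k (y t k - y t r) * (F k - F r)).
Proof.
move=> dy.
rewrite (_ : (fun s => _) = \sum_k (fun s => (y s k - y s r) ^+ 2)); last first.
  by apply/funext => s; rewrite /dev fct_sumE.
rewrite mulr_sumr; apply: is_derive_sum => k.
have d1 : is_derive t 1 (fun s => y s k - y s r) (F k - F r) by exact: is_deriveB.
have d2 := @is_deriveM _ _ _ _ _ _ _ _ d1 d1.
by apply: (is_derive_eq d2); rewrite /GRing.scale/=; ring.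
Qed.

Variables (omega : R) (A : digraph N) (g : circle R -> R).

(** The lifts of the coordinates given by the notion of velocity are translated by
    multiples of [2 pi] so as to start at a displacement of small [dev]. *)
Lemma solution_lift u v : solutions omega A g u -> tube r phi v (u 0) ->
  exists y : R -> 'I_N -> R,
    [/\ forall t, u t = wrap phi (y t), dev r (y 0) < v &
        forall k (t : R),
          is_derive t 1 (fun s => y s k) (network_field omega A g (u t) k)].
Proof.
move=> su [x0 xv /= u0].
have /choice[y yE] : forall k, exists y : R -> R,
    [/\ forall t, u t 0 k = to_circle (phi k + y t), y 0 = x0 k &
        forall t : R, is_derive t 1 y (network_field omega A g (u t) k)].
  move=> k; have [X [XE dX]] := su k.
  have := XE 0; rewrite -u0 mxE => /esym/to_circle_eq[m hm].
  exists (fun t => X t - (phi k + 2 * pi * m%:~R)); split.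
  - move=> t; rewrite XE -(to_circle_int (- m) (X t)) mulrNz.
    by congr to_circle; ring.
  - by rewrite hm; ring.
  - move=> t; rewrite -[network_field _ _ _ _ _]subr0.
    have dc := is_derive_cst (phi k + 2 * pi * m%:~R : R) t (1 : R).
    exact: (@is_deriveB _ _ _ X (cst _) _ _ _ _ (dX t) dc).
exists (fun t k => y k t); split.
- by move=> t; apply/rowP => k; rewrite mxE; have [] := yE k.
- by rewrite (_ : (fun k => y k 0) = x0)//; apply/funext => k; have [] := yE k.
- by move=> k; have [] := yE k.
Qed.

Variables (v0 kappa : R).
Hypothesis kappa_gt0 : 0 < kappa.
Hypothesis dissip : forall x, dev r x < v0 ->
  \sum_k (x k - x r) * (network_field omega A g (wrap phi x) k -
                        network_field omega A g (wrap phi x) r) <= - kappa * dev r x.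

Lemma tube_contracts u v : v <= v0 -> solutions omega A g u -> tube r phi v (u 0) ->
  forall t, 0 <= t -> tube r phi (v * expR (- (2 * kappa) * t)) (u t).
Proof.
move=> vv0 su u0 t t0; have [y [uE y0 dy]] := solution_lift su u0.
rewrite uE; exists (y t) => //=.
apply: (@le_lt_trans _ _ (dev r (y 0) * expR (- (2 * kappa) * t))); last first.
  by rewrite ltr_pM2r ?expR_gt0.
have dV s := is_derive_dev (fun k => dy k s).
apply: (decay _ dV _ (lt_le_trans y0 vv0)) => //.
- by rewrite mulr_ge0// ltW.
- by move=> s; exact: dev_ge0.
- by move=> s /dissip; rewrite -uE; lra.
Qed.

End Decay.

(** * Asymptotic stability of the tubes and of the phase-locked state *)

Section Stability.
Variables (R : realType) (N : nat) (r : 'I_N) (phi : 'I_N -> R).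
Local Open Scope quotient_scope.

Lemma phase_class_eq (theta theta' : 'rV[circle R]_N) :
  phase_class theta = phase_class theta' <-> exists c, theta = theta' + const_mx c.
Proof.
have E : phase_class theta = phase_class theta' <-> theta - theta' \in @phase_shift R N.
  rewrite Quotient.idealrBE.
  exact: (rwP (@eqP (Quotient.quot (@phase_shift R N))
    (\pi theta) (\pi theta'))).
rewrite E; split=> [/asboolP[c hc]|[c ->]]; first by exists c; rewrite -hc addrC subrK.
by rewrite addrAC subrr add0r; apply/asboolP; exists c.
Qed.

Lemma wrap_shift x (c : R) :
  wrap phi (fun k => x k + c) = wrap phi x + const_mx (to_circle c) :> 'rV_N.
Proof. by apply/rowP => k; rewrite !mxE -to_circleD addrA. Qed.

Lemma tube_shift v (theta : 'rV[circle R]_N) c :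
  tube r phi v theta -> tube r phi v (theta + const_mx c).
Proof.
move=> [x xv <-]; have [a _ ->] := to_circle_surj 0 c.
by exists (fun k => x k + a); [rewrite /= dev_shift|exact: wrap_shift].
Qed.

Lemma phase_class_tube v (theta : 'rV[circle R]_N) :
  [set phase_class eta | eta in tube r phi v] (phase_class theta) ->
  tube r phi v theta.
Proof. by move=> [eta he /esym/phase_class_eq[c ->]]; exact: tube_shift. Qed.

Lemma phase_class_tube_nbhs v : 0 < v ->
  nbhs (phase_class (wrap phi (fun=> 0)))
    [set phase_class eta | eta in tube r phi v].
Proof.
move=> v0; set U := (X in nbhs _ X); rewrite nbhsE; exists U => //; split; last first.
  exists (wrap phi (fun=> 0)) => //; exists (fun=> 0) => //=.
  by rewrite dev_cst0.
suff : open (@phase_class R N @^-1` U) by [].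
rewrite (_ : _ @^-1` _ = tube r phi v); first exact: tube_open.
apply/seteqP; split => theta; first exact: phase_class_tube.
by move=> h; exists theta.
Qed.

(** Every point of a tube can be shifted so that its root coordinate is that of
    [phi]; then all coordinates are close to those of [phi]. *)
Lemma nbhs_phase_class U : nbhs (phase_class (wrap phi (fun=> 0))) U ->
  exists2 v, 0 < v & forall theta, tube r phi v theta -> U (phase_class theta).
Proof.
move=> /(@pi_continuous _ (Quotient.quot (@phase_shift R N))) /nbhs_wrap[e e0 he].
exists (e ^+ 2); first exact: exprn_gt0.
move=> _ [x /= xe <-].
have -> : phase_class (wrap phi x) = phase_class (wrap phi (fun k => x k + - x r)).
  apply/phase_class_eq; exists (to_circle (x r)); rewrite -wrap_shift; congr wrap.
  by apply/funext => k; rewrite subrK.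
apply: he => k; rewrite subr0; apply: sqr_lt_norm => //.
exact: le_lt_trans (dev_coord r x k) xe.
Qed.

Variables (omega : R) (A : digraph N) (g : circle R -> R) (v0 kappa : R).
Hypothesis v0_gt0 : 0 < v0.
Hypothesis kappa_gt0 : 0 < kappa.
Hypothesis dissip : forall x, dev r x < v0 ->
  \sum_k (x k - x r) * (network_field omega A g (wrap phi x) k -
                        network_field omega A g (wrap phi x) r) <= - kappa * dev r x.

Let contracts u v (vv0 : v <= v0) :=
  @tube_contracts R N r phi omega A g v0 kappa kappa_gt0 dissip u v vv0.

Let tube_invariant u v : 0 < v -> v <= v0 -> solutions omega A g u ->
  tube r phi v (u 0) ->
  forall t, 0 <= t -> tube r phi v (u t).
Proof.
move=> v_gt0 vv0 su u0 t t0; apply: tube_le (contracts vv0 su u0 t0).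
rewrite ger_pMr// -expR0 ler_expR mulNr oppr_le0 mulr_ge0// mulr_ge0// ltW//.
Qed.

Let enters u e : 0 < e -> solutions omega A g u -> tube r phi v0 (u 0) ->
  \forall t \near +oo, tube r phi e (u t).
Proof.
move=> e0 su u0.
have k2 : 0 < 2 * kappa by rewrite mulr_gt0.
have h := decay_eventually v0 k2 e0.
near=> t.
have t0 : 0 <= t by near: t; apply: nbhs_pinfty_ge; exact: num_real.
apply: tube_le (contracts (lexx _) su u0 t0); apply: ltW; near: t; exact: h.
Unshelve. all: by end_near. Qed.

Lemma stable_class : asymptotically_stable_point (quotient_solutions omega A g)
  (phase_class (wrap phi (fun=> 0))).
Proof.
split.
  move=> U /nbhs_phase_class[v v_gt0 vU].
  have m0 : 0 < Num.min v v0 by rewrite lt_min v_gt0.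
  exists [set phase_class eta | eta in tube r phi (Num.min v v0)].
    exact: phase_class_tube_nbhs.
  move=> _ [theta st <-] /phase_class_tube h t t0; apply: vU.
  apply: (@tube_le _ _ _ _ (Num.min v v0)); first by rewrite ge_min lexx.
  by apply: tube_invariant => //; rewrite ge_min lexx orbT.
exists [set phase_class eta | eta in tube r phi v0].
  exact: phase_class_tube_nbhs.
move=> _ [theta st <-] /phase_class_tube h U /nbhs_phase_class[v v_gt0 vU].
have := enters v_gt0 st h; apply: filterS => t; exact: vU.
Qed.

Lemma stable_tube v : 0 < v -> v < v0 ->
  asymptotically_stable_set (solutions omega A g) (tube r phi v).
Proof.
have tube_nbhs w w' : w < w' -> set_nbhs (closure (tube r phi w)) (tube r phi w').
  move=> ww' theta /(closure_tube ww') h.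
  by apply: open_nbhs_nbhs; split => //; exact: tube_open.
move=> v_gt0 vv0; split.
  move=> U /(tube_basis v_gt0)[v' vv' v'U].
  have m0 : v < Num.min v' v0 by rewrite lt_min vv'.
  exists (tube r phi (Num.min v' v0)); first exact: tube_nbhs.
  move=> u su u0 t t0; apply: v'U.
  apply: (@tube_le _ _ _ _ (Num.min v' v0)); first by rewrite ge_min lexx.
  apply: tube_invariant => //; first exact: lt_trans m0.
  by rewrite ge_min lexx orbT.
exists (tube r phi v0); first exact: tube_nbhs.
move=> u su u0 U hU; have := enters v_gt0 su u0; apply: filterS => t ut.
apply: (@nbhs_singleton _ (u t) U); apply: (hU (u t)); exact: subset_closure.
Qed.

Lemma tube_forward_invariant v : 0 < v -> v < v0 ->
  forward_invariant (solutions omega A g) (tube r phi v).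
Proof. by move=> v_gt0 vv0 u su u0; exact: tube_invariant (ltW vv0) su u0. Qed.

End Stability.

(** * Proof of the theorem *)

Section Field.
Variables (R : realType) (N : nat) (omega : R) (A : digraph N) (g : circle R -> R).

Lemma wrapB (phi x : 'I_N -> R) j k :
  wrap phi x 0 j - wrap phi x 0 k = to_circle (phi j - phi k + (x j - x k)).
Proof. by rewrite !mxE -to_circleB; congr to_circle; ring. Qed.

Lemma rotating_wave_wrap (phi : 'I_N -> R) (Omega t : R) :
  rotating_wave Omega (wrap phi (fun=> 0)) t = wrap phi (fun=> Omega * t).
Proof. by apply/rowP => k; rewrite !mxE -to_circleD addr0 addrC. Qed.

Lemma rotating_wave_solution (phi : 'I_N -> R) :
  (forall c k, network_field omega A g (wrap phi (fun=> c)) k = omega) ->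
  relative_equilibrium omega A g omega (wrap phi (fun=> 0)).
Proof.
move=> h k; exists (fun t => phi k + omega * t); split.
  by move=> t; rewrite rotating_wave_wrap mxE.
move=> t; rewrite rotating_wave_wrap h.
have d1 : is_derive t 1 (fun t : R => omega * t) (omega * 1).
  exact: (@is_deriveZ _ _ _ id omega t 1 1 (is_derive_id _ _)).
have d2 := @is_deriveD _ _ _ (cst (phi k)) _ _ _ _ _ (is_derive_cst _ _ _) d1.
by apply: (is_derive_eq d2); rewrite mulr1 add0r.
Qed.

End Field.

Theorem corollary5 (R : realType) (N : nat) (hN : (2 <= N)%N) (omega : R)
    (A H : digraph N) (hA : loopless A) (hHA : H \subset A)
    (hH : exists D : digraph N, spanning_diverging_tree H D) :
  exists g : circle R -> R,
    [/\ coupling_function g,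
        exists (Omega : R) (theta0 : 'rV[circle R]_N),
          stable_relative_equilibrium omega A g Omega theta0 /\
          effective_graph g A theta0 = H &
        stably_realises omega A H g].
Proof.
have [D [DH Dconn [r [Dr Dk]]]] := hH.
have [eta eta0 [kappa kappa0 dissip]] := perturbed_dissipation R Dconn Dr Dk.
have Aoff j k : (j, k) \in A -> j != k.
  by apply: contraTneq => ->; exact: hA.
have Hoff : H \subset off_diagonal N.
  apply/fintype.subsetP => -[j k] /(fintype.subsetP hHA)/Aoff jk.
  by rewrite inE.
have Hn0 : H != finset.set0.
  have [k kr] : exists k : 'I_N, k != r.
    have : (0 < #|predC1 r|)%N.
      by rewrite cardC1 card_ord -ltnS prednK// (ltn_trans _ hN).
    by case/card_gt0P => k; exists k.
  apply/finset.set0Pn; exists (parent D k, k); apply: (fintype.subsetP DH).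
  by rewrite (parentP Dk _ kr).
(* Tree edges carry the slopes that make the tree dissipative, the other edges of
   [H] slopes small enough to count as perturbations. *)
pose sg (j k : 'I_N) : R :=
  if (j, k) \in D then weight R Dconn Dr Dk k else eta / 2.
have sg0 j k : (j, k) \in H -> 0 < sg j k.
  by move=> _; rewrite /sg; case: ifP => _; [exact: weight_gt0|rewrite divr_gt0].
(* With [tau <= eta] the nonlinearity of a tree edge is within the error allowed;
   with [tau <= 1] the whole coupling of another edge is at most
   [eta / 2 * (1 + tau) <= eta] times the phase difference. *)
pose tau := Num.min eta 1.
have tau0 : 0 < tau by rewrite lt_min eta0/=.
have [tau1 tau2] : tau <= eta /\ tau <= 1 by rewrite !ge_min !lexx orbT.
have [g gC [d d0 gloc]] := exists_coupling Hn0 Hoff sg0 tau0.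
exists g; pose phi := @phase R N.
(* All phase differences of a point of [tube v0] are within [d] of those of
   [phi], since [(a - b)^2 <= 2 (a^2 + b^2)]. *)
pose v0 := d ^+ 2 / 4.
have v0_gt0 : 0 < v0 by rewrite divr_gt0// exprn_gt0.
have close x : dev r x < v0 -> forall j k, `|x j - x k| < d.
  move=> xv j k; apply: sqr_lt_norm => //.
  have := dev_coord r x j; have := dev_coord r x k.
  have -> : x j - x k = (x j - x r) - (x k - x r) by ring.
  move: (x j - x r) (x k - x r) xv => a b; rewrite /v0.
  have := sqr_ge0 (a + b); rewrite sqrrD sqrrB; move: (d ^+ 2) => q; lra.
pose err (x : 'I_N -> R) (k : 'I_N) := network_field omega A g (wrap phi x) k - omega
   - weight R Dconn Dr Dk k * (x (parent D k) - x k).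
have errP x : (forall j k, `|x j - x k| < d) ->
    forall k, `|err x k| <= eta * \sum_j `|x j - x k|.
  move=> xd k.
  have -> : err x k = \sum_j
      (adjacency R A j k * g (to_circle (phi j - phi k + (x j - x k)))
       - (if (j, k) \in D then weight R Dconn Dr Dk k * (x j - x k) else 0)).
    rewrite sumrB -big_mkcond/= /err /network_field [omega + _]addrC addrK.
    congr (_ - _).
      by apply: eq_bigr => j _; rewrite wrapB.
    have [->|kr] := eqVneq k r.
      rewrite parent_root// subrr mulr0 big_pred0// => j; exact: root_in.
    by rewrite (big_pred1 (parent D k))// => j; rewrite (parentP Dk)//.
  apply: le_trans (ler_norm_sum _ _ _) _; rewrite mulr_sumr; apply: ler_sum => j _.
  rewrite mxE; have [jkA|jkA] := boolP ((j, k) \in A); last first.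
    rewrite mul0r ifF; first by rewrite subr0 normr0 mulr_ge0// ltW.
    by apply: contraNF jkA => /(fintype.subsetP DH)/(fintype.subsetP hHA).
  rewrite mul1r; have [h1 h2 _] := gloc j k _ (Aoff _ _ jkA) (xd j k).
  have s0 := normr_ge0 (x j - x k).
  have [jkD|jkD] := boolP ((j, k) \in D).
    have := h1 (fintype.subsetP DH _ jkD); rewrite /sg jkD => /le_trans; apply.
    have w1 := weight_le1 R Dconn Dr Dk k; have w0 := weight_gt0 R Dconn Dr Dk k.
    apply: (@le_trans _ _ (1 * (tau * `|x j - x k|))).
      by rewrite ler_wpM2r// mulr_ge0// ltW.
    by rewrite mul1r ler_wpM2r.
  rewrite subr0; have [jkH|jkH] := boolP ((j, k) \in H); last first.
    by rewrite h2// normr0 mulr_ge0// ltW.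
  have := h1 jkH; rewrite /sg (negbTE jkD).
  set a := g _; set s := x j - x k => h.
  rewrite (_ : a = (a - eta / 2 * s) + eta / 2 * s); last by ring.
  apply: le_trans (ler_normD _ _) _; rewrite [`|eta / 2 * s|]normrM.
  rewrite (gtr0_norm (divr_gt0 eta0 _))//.
  have : tau * `|s| <= 1 * `|s| by rewrite ler_wpM2r.
  rewrite -(ler_pM2l (divr_gt0 eta0 (ltr0n R 2))); lra.
have dissip' x : dev r x < v0 ->
  \sum_k (x k - x r) * (network_field omega A g (wrap phi x) k -
                        network_field omega A g (wrap phi x) r) <= - kappa * dev r x.
  move=> xv; have := dissip x (err x) (errP x (close x xv)).
  congr (_ <= _); apply: eq_bigr => k _; congr (_ * _).
  rewrite /err (parent_root Dr); ring.
have field_cst c k : network_field omega A g (wrap phi (fun=> c)) k = omega.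
  have cd (i j : 'I_N) : `|c - c| < d by rewrite subrr normr0.
  have := errP (fun=> c) cd k; rewrite big1 => [|j _]; last by rewrite subrr normr0.
  by rewrite mulr0 normr_le0 /err subrr mulr0 subr0 subr_eq0 => /eqP.
have graph theta : tube r phi v0 theta -> effective_graph g A theta = H.
  move=> [x xv <-]; apply/setP => -[j k]; rewrite inE/= wrapB mxE.
  have [jkA|jkA] := boolP ((j, k) \in A); last first.
    rewrite eqxx/=; apply/esym; apply: contraNF jkA; exact: (fintype.subsetP hHA).
  rewrite oner_eq0/=.
  have [_ _ h] := gloc j k _ (Aoff _ _ jkA) (close x xv j k).
  apply/asboolP/idP => [nd|jkH]; first by apply: contraT => /h.
  by move=> /h; rewrite jkH.
have in0 v : 0 < v -> tube r phi v (wrap phi (fun=> 0)).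
  by move=> v_gt0; exists (fun=> 0) => //=; rewrite dev_cst0.
split => //.
- exists omega, (wrap phi (fun=> 0)); split; last exact/graph/in0.
  split; first exact: rotating_wave_solution.
  exact: (stable_class v0_gt0 kappa0 dissip').
- have v2 : 0 < v0 / 2 by rewrite divr_gt0.
  have v2v : v0 / 2 < v0 by rewrite ltr_pdivrMr// ltr_pMr// ltr1n.
  exists (tube r phi (v0 / 2)); split.
  + by exists (wrap phi (fun=> 0)); exact: in0.
  + exact: tube_open.
  + exact: (tube_forward_invariant kappa0 dissip').
  + exact: (stable_tube kappa0 dissip').
  + by move=> theta /(tube_le (ltW v2v)); exact: graph.
Qed.
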